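(* For every fixed $k\in\mathbb{N}_0$ and $r\in[0,\infty)$ such that $\max\{k,r\}>0$ we have $$\lim_{n\to\infty}\sqrt{\log n}\,\sup_{j\in\mathbb{Z}}\left|\mathbb{P}\bigl[\mathrm{Lah}(n,k)_r=j\bigr]-\frac{\exp\Bigl\{-\frac{(j-(k+r)\log n)^2}{2(k+r)\log n}\Bigr\}}{\sqrt{2\pi(k+r)\log n}}\right|=0.$$
   Context: $\mathbb{N}=\{1,2,\ldots\}$, $\mathbb{N}_0=\mathbb{N}\cup\{0\}$. Let $\genfrac{[}{]}{0pt}{}{n}{k}$ and $\genfrac{\{}{\}}{0pt}{}{n}{k}$ be the (unsigned) Stirling numbers of the first kind (number of permutations of $\{1,\dots,n\}$ with exactly $k$ cycles) and of the second kind (number of partitions of $\{1,\dots,n\}$ into $k$ non-empty subsets). For $n\in\mathbb{N}_0$, $k\in\{0,\ldots,n\}$ and $r\in\mathbb{R}$ the $r$-Stirling numbers are defined (with $0^0=1$) by $$\genfrac{[}{]}{0pt}{}{n}{k}_r=\sum_{j=k}^n\genfrac{[}{]}{0pt}{}{n}{j}\binom{j}{k}r^{j-k},\qquad \genfrac{\{}{\}}{0pt}{}{n}{k}_r=\sum_{j=k}^n\binom{n}{j}\genfrac{\{}{\}}{0pt}{}{j}{k}r^{n-j}.$$ The $r$-Lah number is $L(n,k)_r=\sum_{j=k}^n\genfrac{[}{]}{0pt}{}{n}{j}_r\genfrac{\{}{\}}{0pt}{}{j}{k}_r$. For $n\in\mathbb{N}$, $k\in\{0,\ldots,n\}$, $r\in[0,\infty)$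 with $\max\{k,r\}>0$, $\mathrm{Lah}(n,k)_r$ denotes a random variable with the $r$-Lah distribution $$\mathbb{P}[\mathrm{Lah}(n,k)_r=j]=\frac{1}{L(n,k)_r}\genfrac{[}{]}{0pt}{}{n}{j}_r\genfrac{\{}{\}}{0pt}{}{j}{k}_r,\qquad j\in\{k,k+1,\ldots,n\}$$ (so the probability is $0$ for integers $j\notin\{k,\ldots,n\}$). *)

(* Defs.v *)
From mathcomp Require Import all_boot all_order all_algebra perm.
From mathcomp Require Import all_classical all_reals all_analysis.

Set Implicit Arguments.
Unset Strict Implicit.
Unset Printing Implicit Defensive.

Import Order.TTheory GRing.Theory Num.Theory.

Local Open Scope ring_scope.
Local Open Scope classical_set_scope.

Definition stirling1 (n k : nat) : nat :=
  #|[set s : 'S_n | #|porbits s| == k]%SET|.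

Definition stirling2 (n k : nat) : nat :=
  #|[set B : {set {set 'I_n}} | finset.partition B [set: 'I_n]%SET & #|B| == k]%SET|.

Definition rstirling1 {R : realType} (r : R) (n k : nat) : R :=
  \sum_(k <= j < n.+1) (stirling1 n j)%:R * ('C(j, k))%:R * r ^+ (j - k).

Definition rstirling2 {R : realType} (r : R) (n k : nat) : R :=
  \sum_(k <= j < n.+1) ('C(n, j))%:R * (stirling2 j k)%:R * r ^+ (n - j).

Definition rlah {R : realType} (r : R) (n k : nat) : R :=
  \sum_(k <= j < n.+1) rstirling1 r n j * rstirling2 r j k.

Definition rlah_pmf {R : realType} (r : R) (n k : nat) (z : int) : R :=
  if z is Posz j then
    if (k <= j <= n)%N
    then (rlah r n k)^-1 * (rstirling1 r n j * rstirling2 r j k)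
    else 0
  else 0.

Definition has_rlah_distribution {R : realType} {d : measure_display}
    {T : measurableType d} (P : probability T R) (X : {RV P >-> R})
    (r : R) (n k : nat) : Prop :=
  forall j : int, P (X @^-1` [set j%:~R]) = (rlah_pmf r n k j)%:E.

(* The density at x of the normal law with mean v and variance v. *)
Definition normal_approx {R : realType} (v x : R) : R :=
  expR (- ((x - v) ^+ 2 / (2 * v))) / Num.sqrt (2 * pi * v).

(* Main.v *)
Require Import Defs.
From mathcomp Require Import all_boot all_order all_algebra perm.
From mathcomp Require Import all_classical all_reals all_analysis.
From mathcomp Require Import ring lra zify.

Set Implicit Arguments.
Unset Strict Implicit.
Unset Printing Implicit Defensive.

Import Order.TTheory GRing.Theory Num.Theory.
Import numFieldNormedType.Exports.

Local Open Scope ring_scope.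

(** Write th = k + r. Expanding the r-Stirling numbers of the second kind gives
    [k! {j,k}_r = th^j + \sum_(i < k) c_i (i + r)^j], and summed against the
    r-Stirling numbers of the first kind the terms [i < k] are smaller than the
    leading one by a factor [O(1/n)]. Hence Lah(n,k)_r is within [O(1/n)] of the
    law with weights proportional to [[n,j]_r th^j], whose generating function
    [\prod_(m < n) (th x + r + m)] exhibits it as a sum of independent Bernoulli
    variables of parameters [th / (th + r + m)]. The Chen-Stein method for the
    single points [j] bounds the distance to the Poisson weights of parameter
    [l = th ln n] by [O(1/l)], because the sum of the parameters is [l + O(1)] and
    the sum of their squares is bounded. Finally the Poisson weights satisfy the
    local limit theorem: Stirling's formula (with the constant given by Wallis'
    product) covers [|j - l| <= K sqrt l], and outside that window unimodality
    forces [sqrt l * pois l j <= 1 / K]. *)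

(** * Stirling numbers of the first kind *)

Lemma porbit_fixed (T : finType) (s : {perm T}) (a : T) :
  s a = a -> porbit s a = [set a]%SET.
Proof.
move=> sa; apply/setP => x; rewrite inE; apply/porbitP/eqP => [[i ->]|->].
  by elim: i => [|i IH]; rewrite ?expg0 ?perm1// expgSr permM IH.
by exists 0%N; rewrite expg0 perm1.
Qed.

(** A transposition of points in distinct orbits merges these orbits, and a fixed point [a] is alone
    in its orbit. *)
Lemma porbits_mul_tperm_fixed (T : finType) (s : {perm T}) (a i : T) :
  s a = a -> i != a -> #|porbits (tperm a i * s)|.+1 = #|porbits s|.
Proof.
move=> sa ia; have := porbits_mul_tperm s a i.
rewrite porbit_sym (porbit_fixed sa) inE ia eq_sym ia /= => /eqP.
by rewrite -[1.*2%N]/2%N addn2 addn1 eqSS => /eqP.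
Qed.

Lemma perm_on_setU1_tperm (T : finType) (A : {set T}) (a i : T)
    (s : {perm T}) : a \notin A -> perm_on A s -> i \in a |: A ->
  perm_on (a |: A) (tperm a i * s)%g.
Proof.
move=> aA sA iA; apply: perm_onM; last first.
  exact: (fintype.subset_trans sA (finset.subsetUr _ _)).
apply: fintype.subset_trans (tperm_on a i) _.
by apply/fintype.subsetP => x /set2P[->|->] //; exact: setU11.
Qed.

(** A permutation [t] supported in [a |: A] is encoded by [i = t^-1 a] together with
    [tperm a i * t], which fixes [a] and hence is supported in [A]. *)
Lemma sum_perm_on_setU1 (T : finType) (V : nmodType) (A : {set T}) (a : T)
    (F : {perm T} -> V) : a \notin A ->
  \sum_(s | perm_on (a |: A) s) F s =
  \sum_(i in a |: A) \sum_(s | perm_on A s) F (tperm a i * s)%g.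
Proof.
move=> aA.
rewrite (partition_big (fun t : {perm T} => (t^-1)%g a)
  (fun i => i \in a |: A)) /=; last first.
  by move=> t tA; rewrite (perm_closed _ (perm_onV tA)) setU11.
apply: eq_bigr => i iA.
rewrite (reindex_onto (fun s => tperm a i * s)%g (fun s => tperm a i * s)%g) /=; last first.
  by move=> t _; rewrite mulgA tperm2 mul1g.
apply: eq_bigl => s; rewrite mulgA tperm2 mul1g eqxx andbT.
apply/andP/idP => [[sA /eqP si]|sA].
  apply/fintype.subsetP => x /[!inE] sx.
  have saa : s a = a.
    by have := permKV (tperm a i * s)%g a; rewrite si permM tpermR.
  have xa : x != a by apply: contraNneq sx => ->; rewrite saa.
  have siA : perm_on (a |: A) s.
    have -> : s = (tperm a i * (tperm a i * s))%g by rewrite mulgA tperm2 mul1g.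
    apply: perm_onM sA; apply: fintype.subset_trans (tperm_on a i) _.
    by apply/fintype.subsetP => y /set2P[->|->] //; exact: setU11.
  have /fintype.subsetP/(_ x) := siA; rewrite !inE => /(_ sx).
  by rewrite (negbTE xa).
split; first exact: perm_on_setU1_tperm.
have saa : s a = a by rewrite (out_perm sA).
by apply/eqP/(@perm_inj _ (tperm a i * s)%g); rewrite permKV permM tpermR saa.
Qed.

(* Stated for permutations supported in [A] so that the induction stays inside a
   fixed type; the powers of ['X] absorb the fixed points outside [A]. *)
Lemma perm_on_porbits_gf (R : idomainType) (T : finType) (A : {set T}) :
  (\sum_(s : {perm T} | perm_on A s) 'X^#|porbits s|) * 'X^#|A| =
  'X^#|T| * \prod_(i < #|A|) ('X + i%:R) :> {poly R}.
Proof.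
elim: {A}_.+1 {-2}A (ltnSn #|A|) => // m IH A Am.
have [->|[a aA]] := set_0Vmem A.
  rewrite cards0 big_ord0 expr0 !mulr1 (big_pred1 (1%g : {perm T})).
    have -> : porbits (1%g : {perm T}) = (@finset.set1 T) @: T.
      by apply: eq_imset => x; apply/porbit_fixed/perm1.
    by rewrite card_imset//; exact: finset.set1_inj.
  move=> s; apply/idP/eqP => [sA|->]; last exact: perm_on1.
  by apply: (perm_on_id sA); rewrite cards0.
rewrite -(finset.setD1K aA); set B := (A :\ a)%SET.
have aB : a \notin B by rewrite !inE eqxx.
have Bm : (#|B| < m)%N by move: Am; rewrite (cardsD1 a A) aA.
rewrite cardsU1 aB add1n sum_perm_on_setU1// big_ord_recr /=.
rewrite mulrA -(IH B Bm) big_setU1//= tperm1.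
under eq_bigr do rewrite mul1g.
set S := \sum_(s | _) _.
(* For [i] in [B] the transposition inserts [a] into the cycle of [i], which costs one orbit,
   restored here by ['X]. The choice [i = a] leaves [s] unchanged. *)
have E i : i \in B ->
    (\sum_(s | perm_on B s) 'X^#|porbits (tperm a i * s)%g|) * 'X = S :> {poly R}.
  move=> iB; rewrite mulr_suml; apply: eq_bigr => s sB.
  rewrite -exprSr porbits_mul_tperm_fixed// ?(out_perm sB)//.
  by apply: contraNneq aB => <-.
have {}E : (\sum_(i in B) \sum_(s | perm_on B s) 'X^#|porbits (tperm a i * s)%g|) * 'X =
    S * #|B|%:R :> {poly R}.
  by rewrite mulr_suml (eq_bigr _ E) sumr_const mulr_natr.
rewrite exprSr mulrA mulrAC mulrDl E; ring.
Qed.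

Lemma sum_stirling1 (R : idomainType) n :
  \sum_(j < n.+1) (stirling1 n j)%:R *: 'X^j = \prod_(i < n) ('X + i%:R) :> {poly R}.
Proof.
have := @perm_on_porbits_gf R 'I_n [set: 'I_n].
(* With full support both sides carry the factor ['X^n], which is nonzero and cancels. *)
rewrite cardsT card_ord mulrC => /mulfI; rewrite -size_poly_eq0 size_polyXn => /(_ isT) <-.
rewrite [RHS](eq_bigl predT); last by move=> s; apply/fintype.subsetP => x; rewrite inE.
have L (s : 'S_n) : (#|porbits s| < n.+1)%N.
  by rewrite ltnS -[leqRHS]card_ord; apply: leq_imset_card.
rewrite [RHS](partition_big (fun s : 'S_n => Ordinal (L s)) predT) //=.
apply: eq_bigr => j _.
rewrite (eq_bigr (fun=> 'X^j)); last by move=> s /eqP <-.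
rewrite sumr_const scaler_nat; congr (_ *+ _).
by apply: eq_card => s; rewrite inE /= unfold_in.
Qed.

(** * Stirling numbers of the second kind *)

Section SetPartitions.
Import mathcomp.boot.fintype mathcomp.boot.finset.

(** A function whose nonempty fibers are exactly the blocks of [B] amounts to an injection from the
    blocks into [U]. *)
Lemma card_preim_partition_fiber (T U : finType) (B : {set {set T}}) :
  partition B [set: T]%SET ->
  #|[set f : {ffun T -> U} | preim_partition f [set: T]%SET == B]%SET| =
  (#|U| ^_ #|B|)%N.
Proof.
move=> BP; have [/eqP covB trivB nB0] := and3P BP.
have inB x : pblock B x \in B by rewrite pblock_mem// covB inE.
pose sB := {b : {set T} | b \in B}.
pose blk x : sB := exist _ (pblock B x) (inB x).
have rP (b : sB) : exists x, blk x == b.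
  case: b => b bB; have /set0Pn[x xb] : b != set0 by apply: contraNneq nB0 => <-.
  by exists x; apply/eqP/val_inj => /=; rewrite (def_pblock trivB bB xb).
pose rep b := xchoose (rP b).
have repK : cancel rep blk by move=> b; apply/eqP/(xchooseP (rP b)).
have -> : (#|U| ^_ #|B|)%N = #|[set g : {ffun sB -> U} | injectiveb g]%SET|.
  by rewrite card_inj_ffuns card_sig.
pose F (g : {ffun sB -> U}) : {ffun T -> U} := [ffun x => g (blk x)].
rewrite -(@card_in_imset _ _ F); last first.
  move=> g h _ _ /ffunP E; apply/ffunP => b.
  by have := E (rep b); rewrite !ffunE repK.
apply: eq_card => f; rewrite inE; apply/eqP/imsetP.
  move=> fB.
  have fE x y : (f x == f y) = (pblock B x == pblock B y).
    rewrite eq_pblock// ?covB ?inE// -fB.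
    by rewrite pblock_equivalence_partition ?inE//; split => [|/eqP ->].
  exists [ffun b => f (rep b)].
    rewrite inE; apply/injectiveP => b c /eqP; rewrite !ffunE fE.
    by move=> /eqP E; rewrite -[b]repK -[c]repK; apply: val_inj.
  apply/ffunP => x; rewrite !ffunE; apply/eqP; rewrite fE.
  by apply/eqP; rewrite -[RHS]/(val (blk _)) repK.
move=> [g]; rewrite inE => /injectiveP gI ->.
rewrite -[RHS](preim_partition_pblock BP).
apply: eq_imset => x; apply/setP => y; rewrite !inE !ffunE.
by rewrite (inj_eq gI) -val_eqE.
Qed.

Lemma card_partition_leq (T : finType) (B : {set {set T}}) :
  partition B [set: T]%SET -> (#|B| <= #|T|)%N.
Proof.
move=> BP; have [/eqP covB trivB nB0] := and3P BP.
rewrite -cardsT (card_partition BP) -sum1_card; apply: leq_sum => b bB.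
by rewrite lt0n cards_eq0; apply: contraNneq nB0 => <-.
Qed.

Lemma stirling2_gt n k : (n < k)%N -> stirling2 n k = 0%N.
Proof.
move=> nk; apply/eqP; rewrite cards_eq0 -subset0; apply/subsetP => B.
rewrite !inE => /andP[/card_partition_leq + /eqP Bk].
by rewrite Bk card_ord leqNgt nk.
Qed.

(** Both sides count the functions from ['I_n] to ['I_k], the right one by their partition into
    fibers. *)
Lemma expn_stirling2 n k :
  (k ^ n = \sum_(i < n.+1) stirling2 n i * k ^_ i)%N.
Proof.
have := card_ffun 'I_n 'I_k; rewrite !card_ord => <-.
have L (f : {ffun 'I_n -> 'I_k}) :
    (#|preim_partition f [set: 'I_n]%SET| < n.+1)%N.
  by rewrite ltnS -[leqRHS]card_ord; apply/card_partition_leq/preim_partitionP.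
rewrite -sum1_card (partition_big (fun f => Ordinal (L f)) predT) //=.
apply: eq_bigr => i _.
rewrite (partition_big (fun f : {ffun 'I_n -> 'I_k} => preim_partition f [set: 'I_n]%SET)
  (fun B => partition B [set: 'I_n]%SET && (#|B| == i))) /=; last first.
  by move=> f /eqP <- /=; rewrite eqxx andbT; apply: preim_partitionP.
rewrite (eq_bigr (fun=> k ^_ i)%N).
  by rewrite sum_nat_const; congr (_ * _)%N; apply: eq_card => B; rewrite inE unfold_in.
move=> B /andP[BP /eqP Bi].
rewrite -Bi -[X in (X ^_ _)%N]card_ord -(card_preim_partition_fiber _ BP) -sum1_card.
apply: eq_bigl => f; rewrite inE andbC; case: eqP => //= fB.
by apply/eqP/val_inj; rewrite /= fB.
Qed.

End SetPartitions.

(** Strong induction inverts the triangular system [expn_stirling2]. What matters later is that the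
    leading base [k] has coefficient 1 and that the [c i] do not depend on [n]. *)
Lemma fact_stirling2_expn_comb (R : realType) (k : nat) :
  exists c : nat -> R, forall n,
    (k`! * stirling2 n k)%:R = k%:R ^+ n + \sum_(i < k) c i * i%:R ^+ n :> R.
Proof.
elim/ltn_ind: k => k IH.
have /choice[d dE] : forall i, exists c : nat -> R, (i < k)%N -> forall n,
    (i`! * stirling2 n i)%:R = i%:R ^+ n + \sum_(m < i) c m * m%:R ^+ n :> R.
  move=> i; have [ik|ki] := ltnP i k; last by exists (fun=> 0).
  by have [c cE] := IH i ik; exists c.
pose w i : R := 'C(k, i)%:R.
(* Coefficient of the base [m] in the expansion for [i], padded with zeros up to [k] so that the two
   sums can be exchanged. *)
pose e i m : R := if (m == i :> nat) then 1 else if (m < i)%N then d i m else 0.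
exists (fun m => - \sum_(i < k) w i * e i m) => n.
have eE (i : 'I_k) : (i`! * stirling2 n i)%:R = \sum_(m < k) e i m * m%:R ^+ n :> R.
  rewrite dE// (bigID (fun m : 'I_k => (m < i)%N)) /= addrC.
  congr (_ + _).
    rewrite (bigD1 i) ?ltnn//= /e eqxx mul1r big1 ?addr0// => m /andP[].
    rewrite -leqNgt => im mi.
    by rewrite ifN ?val_eqE// ifN ?mul0r// -leqNgt.
  rewrite (big_ord_widen_cond _ xpredT (fun m => d i m * m%:R ^+ n) (ltnW (ltn_ord i))).
  by apply: eq_bigr => m /= mi; rewrite /e mi ltn_eqF.
have := congr1 (fun m => m%:R : R) (expn_stirling2 n k).
(* Both sums extend to [maxn n k]: terms with [i > n] vanish through [stirling2], those with [i > k]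
   through the falling factorial. *)
have -> : (\sum_(i < n.+1) stirling2 n i * k ^_ i = \sum_(i < k.+1) stirling2 n i * k ^_ i)%N.
  pose F i := (stirling2 n i * k ^_ i)%N.
  have A N : (n <= N)%N -> (\sum_(i < n.+1) F i = \sum_(i < N.+1) F i)%N.
    move=> nN; rewrite (big_ord_widen _ F (nN : n.+1 <= N.+1)%N)
      [RHS](bigID (fun i : 'I_N.+1 => (i < n.+1)%N)) /=.
    by rewrite [X in (_ + X)%N]big1 ?addn0// => i; rewrite -leqNgt /F => /stirling2_gt ->.
  have B N : (k <= N)%N -> (\sum_(i < k.+1) F i = \sum_(i < N.+1) F i)%N.
    move=> nN; rewrite (big_ord_widen _ F (nN : k.+1 <= N.+1)%N)
      [RHS](bigID (fun i : 'I_N.+1 => (i < k.+1)%N)) /=.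
    by rewrite [X in (_ + X)%N]big1 ?addn0// => i; rewrite -leqNgt /F => ki;
      rewrite ffact_small ?muln0.
  by rewrite (A (maxn n k)) ?leq_maxl// (B (maxn n k)) ?leq_maxr.
rewrite big_ord_recr /= ffactnn natrD natrX mulnC => ->.
rewrite addrAC -[LHS]add0r; congr (_ + _).
under [X in _ + X]eq_bigr do rewrite mulNr mulr_suml.
rewrite sumrN exchange_big /= natr_sum; apply/esym/eqP; rewrite subr_eq0; apply/eqP.
apply: eq_bigr => i _.
rewrite -bin_ffact mulnC -mulnA natrM.
by rewrite eE mulr_sumr; apply: eq_bigr => m _; rewrite mulrA.
Qed.

(** * Sums of independent Bernoulli variables *)

Lemma big_nat_ord0 (V : nmodType) (F : nat -> V) m n :
  (forall i, (i < m)%N -> F i = 0) ->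
  \sum_(m <= i < n) F i = \sum_(i < n) F i.
Proof.
move=> F0; rewrite big_geq_mkord [RHS](bigID (fun i : 'I_n => (m <= i)%N)) /=.
by rewrite [X in _ + X]big1 ?addr0// => i; rewrite -ltnNge => /F0.
Qed.

(** The definition is the binomial expansion of the rising factorial after substituting ['X + r] for
    ['X]. The recurrences below are read off this product. *)
Lemma rstirling1_coef (R : realType) (r : R) n j :
  rstirling1 r n j = (\prod_(i < n) ('X + (r + i%:R)%:P))`_j.
Proof.
have -> : \prod_(i < n) ('X + (r + i%:R)%:P) =
    (\sum_(m < n.+1) (stirling1 n m)%:R *: 'X^m) \Po ('X + r%:P).
  rewrite sum_stirling1 rmorph_prod /=; apply: eq_bigr => i _.
  by rewrite comp_polyD comp_polyX -polyC_natr comp_polyC polyCD addrA.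
rewrite raddf_sum /= coef_sum /rstirling1 big_nat_ord0; last first.
  by move=> i ij; rewrite bin_small// mulr0 mul0r.
apply: eq_bigr => m _; rewrite comp_polyZ comp_Xn_poly coefZ -mulrA; congr (_ * _).
rewrite addrC exprDn coef_sum.
have [jm|mj] := ltnP m j.
  rewrite bin_small// mul0r big1// => i _.
  rewrite -polyC_exp coefMn coefCM coefXn gtn_eqF ?mulr0 ?mul0rn//.
  by rewrite (leq_ltn_trans _ jm)// -ltnS.
rewrite (bigD1 (Ordinal (mj : (j < m.+1)%N))) //= big1 ?addr0.
  by rewrite -polyC_exp coefMn coefCM coefXn eqxx mulr1 mulr_natl.
move=> i /eqP/val_eqP /= ij.
by rewrite -polyC_exp coefMn coefCM coefXn eq_sym (negbTE ij) mulr0 mul0rn.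
Qed.

Lemma rstirling1_gt (R : realType) (r : R) n j :
  (n < j)%N -> rstirling1 r n j = 0.
Proof. by move=> nj; rewrite /rstirling1 big_geq. Qed.

Lemma rstirling1_ge0 (R : realType) (r : R) n j :
  0 <= r -> 0 <= rstirling1 r n j.
Proof. by move=> r0; apply: sumr_ge0 => i _; rewrite !mulr_ge0// exprn_ge0. Qed.

Lemma rstirling100 (R : realType) (r : R) : rstirling1 r 0 0 = 1.
Proof. by rewrite rstirling1_coef big_ord0 coef1. Qed.

Lemma rstirling1S0 (R : realType) (r : R) n :
  rstirling1 r n.+1 0 = (r + n%:R) * rstirling1 r n 0.
Proof.
by rewrite !rstirling1_coef big_ord_recr /= mulrDr coefD coefMX add0r coefMC mulrC.
Qed.

Lemma rstirling1SS (R : realType) (r : R) n j :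
  rstirling1 r n.+1 j.+1 = (r + n%:R) * rstirling1 r n j.+1 + rstirling1 r n j.
Proof.
by rewrite !rstirling1_coef big_ord_recr /= mulrDr coefD coefMX coefMC mulrC addrC.
Qed.

Lemma rstirling1_sum (R : realType) (r x : R) n :
  \sum_(j < n.+1) rstirling1 r n j * x ^+ j = \prod_(i < n) (x + r + i%:R).
Proof.
transitivity (\prod_(i < n) ('X + (r + i%:R)%:P)).[x]; last first.
  by rewrite horner_prod; apply: eq_bigr => i _; rewrite hornerD hornerX hornerC addrA.
rewrite (@horner_coef_wide _ n.+1).
  by apply: eq_bigr => i _; rewrite rstirling1_coef.
elim: n => [|n IH]; first by rewrite big_ord0 size_poly1.
by rewrite big_ord_recr /= (leq_trans (size_polyMleq _ _))// size_XaddC addn2.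
Qed.

(** By the binomial theorem, the convolution with powers of [r] shifts every base [i] of the
    expansion to [i + r]. *)
Lemma fact_rstirling2_comb (R : realType) (r : R) (k : nat) :
  exists c : nat -> R, forall n,
    k`!%:R * rstirling2 r n k =
    (k%:R + r) ^+ n + \sum_(i < k) c i * (i%:R + r) ^+ n :> R.
Proof.
have [c cE] := fact_stirling2_expn_comb R k; exists c => n.
rewrite /rstirling2 big_nat_ord0 => [|i ik]; last first.
  by rewrite stirling2_gt// mulr0 mul0r.
rewrite mulr_sumr.
have B x : (x%:R + r) ^+ n = \sum_(j < n.+1) 'C(n, j)%:R * (x%:R ^+ j * r ^+ (n - j)).
  by rewrite addrC exprDn; apply: eq_bigr => j _; rewrite mulr_natl mulrC.
rewrite B; under [X in _ = _ + X]eq_bigr do rewrite B mulr_sumr.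
rewrite exchange_big -big_split /=; apply: eq_bigr => j _.
transitivity ('C(n, j)%:R * ((k`! * stirling2 j k)%:R * r ^+ (n - j))).
  by rewrite natrM; ring.
rewrite cE mulrDl mulrDr mulr_suml mulr_sumr; congr (_ + _).
by apply: eq_bigr => i _; ring.
Qed.

(* The expectation of [g W], where [W] is a sum of [n] independent Bernoulli
   variables of parameters [p 0, ..., p n.-1]. *)
Fixpoint bernE (R : realType) (p : nat -> R) n (g : nat -> R) : R :=
  if n is m.+1 then
    (1 - p m) * bernE p m g + p m * bernE p m (fun j => g j.+1)
  else g 0%N.

(** The factor [(th x + r + m) / (th + r + m)] is the generating function of a Bernoulli variable of
    parameter [th / (th + r + m)]. The induction matches the recursion of [bernE] with that of
    [rstirling1]. *)
Lemma bernE_rstirling1 (R : realType) (r th : R) n (g : nat -> R) :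
  0 <= r -> 0 < th ->
  bernE (fun m => th / (th + r + m%:R)) n g =
  (\sum_(j < n.+1) rstirling1 r n j * th ^+ j * g j)
    / \prod_(i < n) (th + r + i%:R).
Proof.
move=> r0 th0; elim: n g => [|n IH] g /=.
  by rewrite big_ord0 big_ord_recr /= big_ord0 rstirling100 add0r !mul1r divr1.
rewrite !IH [X in _ = _ / X]big_ord_recr /=.
have D0 : th + r + n%:R != 0 by rewrite gt_eqF// -addrA ltr_wpDr// addr_ge0.
have P0 : \prod_(i < n) (th + r + i%:R) != 0.
  by rewrite gt_eqF// prodr_gt0// => i _; rewrite -addrA ltr_wpDr// addr_ge0.
suff -> : \sum_(j < n.+2) rstirling1 r n.+1 j * th ^+ j * g j =
   (r + n%:R) * (\sum_(j < n.+1) rstirling1 r n j * th ^+ j * g j) +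
   th * (\sum_(j < n.+1) rstirling1 r n j * th ^+ j * g j.+1).
  by field; apply/andP; split.
rewrite big_ord_recl /= rstirling1S0 expr0.
under eq_bigr do rewrite /bump /= add1n rstirling1SS mulrDl mulrDl.
rewrite big_split /= addrA; congr (_ + _).
  rewrite big_ord_recr /= (rstirling1_gt _ (ltnSn n)) mulr0 !mul0r addr0.
  rewrite [in RHS]big_ord_recl /= mulrDr [X in _ = _ + X]mulr_sumr expr0 !mulrA; congr (_ + _).
  by apply: eq_bigr => i _; rewrite /bump /= add1n !mulrA.
by rewrite mulr_sumr; apply: eq_bigr => i _; rewrite exprS; ring.
Qed.

Lemma bernE_ext (R : realType) (p : nat -> R) n (g h : nat -> R) :
  g =1 h -> bernE p n g = bernE p n h.
Proof.
elim: n g h => [|n IH] g h gh /=; first exact: gh.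
by rewrite (IH g h gh) (IH _ (fun j => h j.+1) (fun j => gh j.+1)).
Qed.

Lemma bernED (R : realType) (p : nat -> R) n (g h : nat -> R) :
  bernE p n (fun j => g j + h j) = bernE p n g + bernE p n h.
Proof. by elim: n g h => [|n IH] g h //=; rewrite !IH; ring. Qed.

Lemma bernEZ (R : realType) (p : nat -> R) n a (g : nat -> R) :
  bernE p n (fun j => a * g j) = a * bernE p n g.
Proof. by elim: n g => [|n IH] g //=; rewrite !IH; ring. Qed.

Lemma bernE_cst (R : realType) (p : nat -> R) n a : bernE p n (fun=> a) = a.
Proof. by elim: n => [|n IH] //=; rewrite !IH; ring. Qed.

Lemma bernE_norm_le (R : realType) (p : nat -> R) n (g : nat -> R) M :
  (forall i, 0 <= p i <= 1) -> (forall j, `|g j| <= M) -> `|bernE p n g| <= M.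
Proof.
move=> p01; elim: n g => [|n IH] g gM //=.
have /andP[p0 p1] := p01 n.
rewrite (le_trans (ler_normD _ _))// !normrM (ger0_norm p0).
rewrite (@ger0_norm _ (1 - p n)) ?subr_ge0//.
have -> : M = (1 - p n) * M + p n * M by ring.
by apply: lerD; apply: ler_wpM2l; rewrite ?subr_ge0//; apply: IH.
Qed.

(** For a Poisson law the difference would vanish. Conditioning on the last Bernoulli variable
    creates only the new error [p n ^+ 2 * (G2 - G1)], so the errors add up to the sum of
    squares. *)
Lemma bernE_stein_le (R : realType) (p : nat -> R) n (g : nat -> R) M :
  (forall i, 0 <= p i <= 1) -> (forall j, `|g j| <= M) ->
  `|(\sum_(i < n) p i) * bernE p n (fun j => g j.+1)
      - bernE p n (fun j => j%:R * g j)| <= 2 * M * \sum_(i < n) p i ^+ 2.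
Proof.
move=> p01; elim: n g => [|n IH] g gM /=.
  by rewrite !big_ord0 !mul0r subr0 normr0 mulr0.
rewrite !big_ord_recr /=.
have /andP[p0 p1] := p01 n.
set mu := \sum_(i < n) p i; set s2 := \sum_(i < n) _.
have gM' j : `|g j.+1| <= M by [].
have := IH g gM; have := IH (fun j => g j.+1) gM'.
rewrite -/mu -/s2; set G1 := bernE p n (fun j => g j.+1).
set G2 := bernE p n (fun j => g j.+2); set W0 := bernE p n (fun j => j%:R * g j).
set W1 := bernE p n (fun j => j%:R * g j.+1) => H1 H0.
have -> : bernE p n (fun j => j.+1%:R * g j.+1) = W1 + G1.
  by rewrite -bernED; apply: bernE_ext => j; rewrite -natr1 mulrDl mul1r.
have -> : (mu + p n) * ((1 - p n) * G1 + p n * G2) - ((1 - p n) * W0 + p n * (W1 + G1))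
  = (1 - p n) * (mu * G1 - W0) + p n * (mu * G2 - W1) + p n ^+ 2 * (G2 - G1).
  by ring.
have N1 : `|G1| <= M by apply: bernE_norm_le.
have N2 : `|G2| <= M by apply: bernE_norm_le.
have -> : 2 * M * (s2 + p n ^+ 2) =
  (1 - p n) * (2 * M * s2) + p n * (2 * M * s2) + p n ^+ 2 * (2 * M) by ring.
have q0 : 0 <= 1 - p n by rewrite subr_ge0.
rewrite (le_trans (ler_normD _ _))// lerD//.
  rewrite (le_trans (ler_normD _ _))// !normrM (ger0_norm p0) (ger0_norm q0).
  by apply: lerD; apply: ler_wpM2l.
rewrite normrM ger0_norm ?sqr_ge0// ler_wpM2l ?sqr_ge0//.
by rewrite (le_trans (ler_normB _ _))//; lra.
Qed.

(** * Comparison of the r-Lah law with a Bernoulli sum *)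

(** Rests on the index shift [(x + n) * \prod (x + i) = x * \prod (x + 1 + i)]. This is the source
    of the relative error [O(1/n)] of the smaller bases. *)
Lemma prod_rising_le (R : realType) (x y : R) n : 0 <= x -> x + 1 <= y ->
  n%:R * \prod_(i < n) (x + i%:R) <= x * \prod_(i < n) (y + i%:R).
Proof.
move=> x0 xy; have P0 : 0 <= \prod_(i < n) (x + i%:R).
  by apply: prodr_ge0 => i _; rewrite addr_ge0.
apply: (@le_trans _ _ ((x + n%:R) * \prod_(i < n) (x + i%:R))).
  by rewrite ler_wpM2r// lerDr.
rewrite mulrC -(big_ord_recr _ (fun i => x + i%:R)) /= big_ord_recl /= addr0.
rewrite ler_wpM2l//; apply: ler_prod => i _; rewrite /bump /= add1n -natr1.
by rewrite !addr_ge0//=; lra.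
Qed.

Lemma rlah_pmfE (R : realType) (r : R) n k (j : nat) :
  rlah_pmf r n k j = (rlah r n k)^-1 * (rstirling1 r n j * rstirling2 r j k).
Proof.
rewrite /rlah_pmf; case: leqP => //= [kj|jk]; last first.
  by rewrite /rstirling2 big_geq ?mulr0.
by case: leqP => // nj; rewrite rstirling1_gt// mul0r mulr0.
Qed.

Lemma fact_rlah (R : realType) (r : R) n k (c : nat -> R) :
  (forall j, k`!%:R * rstirling2 r j k =
    (k%:R + r) ^+ j + \sum_(i < k) c i * (i%:R + r) ^+ j) ->
  k`!%:R * rlah r n k = \prod_(m < n) (k%:R + r + r + m%:R) +
    \sum_(i < k) c i * \prod_(m < n) (i%:R + r + r + m%:R).
Proof.
move=> cE; rewrite /rlah big_nat_ord0 => [|i ik]; last first.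
  by rewrite /rstirling2 big_geq ?mulr0.
under [X in _ + X]eq_bigr do rewrite -rstirling1_sum mulr_sumr.
rewrite -rstirling1_sum exchange_big -big_split mulr_sumr /=.
apply: eq_bigr => j _; rewrite mulrCA cE mulrDr mulr_sumr; congr (_ + _).
by apply: eq_bigr => i _; rewrite mulrCA.
Qed.

Lemma bernE_point (R : realType) (r th : R) n j : 0 <= r -> 0 < th ->
  bernE (fun m => th / (th + r + m%:R)) n (fun m => (m == j)%:R) =
  rstirling1 r n j * th ^+ j / \prod_(i < n) (th + r + i%:R).
Proof.
move=> r0 th0; rewrite bernE_rstirling1//; congr (_ / _).
have [jn|nj] := ltnP j n.+1; last first.
  rewrite (rstirling1_gt _ nj) mul0r big1// => i _.
  by rewrite ltn_eqF ?mulr0// (leq_trans (ltn_ord i)).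
rewrite (bigD1 (Ordinal jn)) //= eqxx mulr1 big1 ?addr0// => i /eqP/val_eqP /= ij.
by rewrite (negbTE ij) mulr0.
Qed.

(** The difference equals [(e - q * e') / (1 + e')], whose denominator is at least [1 / 2]. *)
Lemma ratio_perturbation (R : realType) (q e e' h : R) :
  0 <= q <= 1 -> `|e| <= h -> `|e'| <= h -> h <= 1 / 2 ->
  `|(q + e) / (1 + e') - q| <= 4 * h.
Proof.
move=> /andP[q0 q1] eh eh' h2.
have [eh1 eh2] := ler_normlP _ _ eh'.
have d0 : 0 < 1 + e' by lra.
have -> : (q + e) / (1 + e') - q = (e - q * e') / (1 + e').
  by field; rewrite gt_eqF.
rewrite normrM normfV (gtr0_norm d0) ler_pdivrMr//.
have : `|e - q * e'| <= 2 * h.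
  rewrite (le_trans (ler_normB _ _))// normrM (ger0_norm q0).
  have := ler_wpM2r (normr_ge0 e') q1; rewrite mul1r; lra.
nra.
Qed.

Lemma rlah_pmf_bern (R : realType) (r : R) (k : nat) :
  0 <= r -> 0 < k%:R + r ->
  exists K : R, 0 <= K /\ forall n, (0 < n)%N -> K <= n%:R ->
    forall j : nat, `|rlah_pmf r n k j -
      bernE (fun m => (k%:R + r) / (k%:R + r + r + m%:R)) n
        (fun m => (m == j)%:R)| <= 2 * K / n%:R.
Proof.
move=> r0 th0; have [c cE] := fact_rstirling2_comb r k.
pose A := \sum_(i < k) `|c i|; pose K := A * (k%:R + r + r).
have A0 : 0 <= A by apply: sumr_ge0.
have K0 : 0 <= K by rewrite mulr_ge0// addr_ge0// ltW.
(* The factor 2 turns [2 * K <= n] into [K / n <= 1 / 2], as [ratio_perturbation] requires. *)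
exists (2 * K); split; first by rewrite mulr_ge0.
move=> n n0 Kn j; have n0' : 0 < n%:R :> R by rewrite ltr0n.
rewrite rlah_pmfE bernE_point//; set th := k%:R + r.
set D := \prod_(i < n) _.
have D0 : 0 < D by apply: prodr_gt0 => i _; rewrite -addrA ltr_wpDr// addr_ge0.
have P i : (i < k)%N ->
    0 <= \prod_(m < n) (i%:R + r + r + m%:R) <= th * n%:R^-1 * D + r * n%:R^-1 * D.
  move=> ik; apply/andP; split; first by apply: prodr_ge0 => m _; rewrite !addr_ge0.
  have ik' : i%:R + 1 <= k%:R :> R by rewrite natr1 ler_nat.
  have := @prod_rising_le R (i%:R + r + r) (th + r) n.
  rewrite -/D => /(_ _ _)/wrap[]; rewrite ?addr_ge0//; first by rewrite /th; lra.
  move=> H; rewrite -mulrDl -mulrDl mulrAC ler_pdivlMr// mulrC (le_trans H)//.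
  by rewrite ler_wpM2r// ?(ltW D0)// /th; lra.
have bnd (f : nat -> R) :
    (forall i, (i < k)%N -> 0 <= f i <= \prod_(m < n) (i%:R + r + r + m%:R)) ->
    `|\sum_(i < k) c i * f i / D| <= K / n%:R.
  move=> fP; rewrite (le_trans (ler_norm_sum _ _ _))//.
  rewrite /K /A -mulrA mulr_suml; apply: ler_sum => i _.
  rewrite -mulrA normrM ler_wpM2l//.
  have /andP[f0 fle] := fP i (ltn_ord i); have /andP[_ Ple] := P i (ltn_ord i).
  rewrite normrM (ger0_norm f0) normfV (gtr0_norm D0) ler_pdivrMr//.
  by rewrite (le_trans fle)// (le_trans Ple)// -!mulrDl.
have k0 : k`!%:R != 0 :> R by rewrite pnatr_eq0 -lt0n fact_gt0.
(* Multiplying by [k!] and dividing by [D] makes the numerator [q + e] and the normalisation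
   [1 + e'], where [q] is the Bernoulli weight and [e], [e'] collect the bases [i < k]. *)
pose q := rstirling1 r n j * th ^+ j / D.
pose e := \sum_(i < k) c i * (rstirling1 r n j * (i%:R + r) ^+ j) / D.
pose e' := \sum_(i < k) c i * \prod_(m < n) (i%:R + r + r + m%:R) / D.
have le1 x : 0 <= x -> 0 <= rstirling1 r n j * x ^+ j <= \prod_(m < n) (x + r + m%:R).
  move=> x0; rewrite mulr_ge0 ?exprn_ge0 ?rstirling1_ge0//= -rstirling1_sum.
  have [jn|nj] := ltnP j n.+1.
    rewrite (bigD1 (Ordinal jn)) //= lerDl sumr_ge0// => i _.
    by rewrite mulr_ge0 ?exprn_ge0 ?rstirling1_ge0.
  rewrite rstirling1_gt// mul0r sumr_ge0// => i _.
  by rewrite mulr_ge0 ?exprn_ge0 ?rstirling1_ge0.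
have -> : (rlah r n k)^-1 * (rstirling1 r n j * rstirling2 r j k) = (q + e) / (1 + e').
  have E1 : q + e = k`!%:R * (rstirling1 r n j * rstirling2 r j k) / D.
    rewrite mulrCA cE mulrDr mulrDl; congr (_ + _); rewrite mulr_sumr mulr_suml.
    by apply: eq_bigr => i _; rewrite (mulrCA (c i)).
  have E2 : 1 + e' = k`!%:R * rlah r n k / D.
    by rewrite (fact_rlah n cE) mulrDl divff ?gt_eqF// mulr_suml.
  rewrite E1 E2 !invfM invrK.
  by rewrite [RHS](_ : _ = (k`!%:R / k`!%:R) * (D^-1 * D) *
      ((rlah r n k)^-1 * (rstirling1 r n j * rstirling2 r j k)));
    [rewrite divff// mulVf ?gt_eqF// !mul1r|ring].
rewrite -/q (_ : 2 * (2 * K) / n%:R = 4 * (K / n%:R)); last by ring.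
apply: ratio_perturbation.
- have /andP[H1 H2] := le1 th (ltW th0).
  by rewrite divr_ge0 ?(ltW D0)//= ler_pdivrMr// mul1r.
- by apply: (bnd (fun i => rstirling1 r n j * (i%:R + r) ^+ j)) => i _;
    apply: le1; rewrite addr_ge0.
- apply: (bnd (fun i => \prod_(m < n) (i%:R + r + r + m%:R))) => i ik.
  by rewrite lexx andbT; have /andP[] := P i ik.
- by rewrite ler_pdivrMr//; lra.
Qed.

Lemma sum_inv_sqr_le (R : realType) n :
  \sum_(1 <= m < n.+1) (m%:R ^+ 2)^-1 <= 2 - n%:R^-1 :> R.
Proof.
(* At [n = 0] the convention [0^-1 = 0] applies; the induction starts at 1, where equality holds. *)
case: n => [|n]; first by rewrite big_geq// invr0; lra.
elim: n => [|n IH]; first by rewrite big_nat1 expr1n invr1; lra.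
rewrite big_nat_recr//= (le_trans (lerD IH (lexx _)))//.
have x0 : 0 < n.+1%:R :> R by rewrite ltr0n.
rewrite -[n.+2%:R]natr1; set x := n.+1%:R in x0 *.
rewrite -subr_ge0 (_ : _ - _ = (x * (x + 1) ^+ 2)^-1).
  by rewrite invr_ge0 mulr_ge0 ?sqr_ge0// ltW.
by field; rewrite !gt_eqF//; lra.
Qed.

(** The upper bound [ln (1 + y) <= y] at [y = - x / (1 + x)], for which [1 + y] is the inverse of
    [1 + x]. *)
Lemma ln1D_ge (R : realType) (x : R) : -1 < x -> x / (1 + x) <= ln (1 + x).
Proof.
move=> x1; have y0 : 0 < 1 + x by lra.
have y0' : 0 < (1 + x)^-1 by rewrite invr_gt0.
have E : (1 + x)^-1 = 1 + - (x / (1 + x)) by field; rewrite gt_eqF.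
have := @le_ln1Dx R (- (x / (1 + x))); rewrite -E lnV ?posrE// => /(_ _).
by rewrite lerN2; apply; lra.
Qed.

Lemma telescope_ln (R : realType) n :
  \sum_(1 <= m < n.+1) ln (1 + m%:R^-1) = ln n.+1%:R :> R.
Proof.
elim: n => [|n IH]; first by rewrite big_geq// ln1.
rewrite big_nat_recr//= IH -lnM ?posrE ?ltr0n ?ltr_wpDr//.
by rewrite mulrDr mulr1 divff ?pnatr_eq0// natr1.
Qed.

(** The term [m = 0] is at most 1 since [th <= c]; the others are at most [th ^+ 2 / m ^+ 2]. *)
Lemma sum_bern_sqr_le (R : realType) (th c : R) n : 0 < th -> th <= c ->
  \sum_(m < n) (th / (c + m%:R)) ^+ 2 <= 1 + 2 * th ^+ 2.
Proof.
move=> th0 thc; have c0 : 0 < c by lra.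
case: n => [|n]; first by rewrite big_ord0; nra.
rewrite -(big_mkord xpredT (fun m => (th / (c + m%:R)) ^+ 2)) big_nat_recl//=.
rewrite -(big_add1 _ _ 0 n.+1 xpredT (fun m => (th / (c + m%:R)) ^+ 2)) lerD//.
  have t0 : 0 <= th / c by rewrite divr_ge0 ?ltW.
  have t1 : th / c <= 1 by rewrite ler_pdivrMr// mul1r.
  by rewrite addr0 exprn_ile1.
have := sum_inv_sqr_le R n; have : 0 <= n%:R^-1 :> R by rewrite invr_ge0.
move=> n0 H; have {H n0}: \sum_(1 <= m < n.+1) (m%:R ^+ 2)^-1 <= 2 :> R by lra.
move=> /(ler_wpM2r (sqr_ge0 th)); apply: le_trans.
rewrite mulr_suml big_nat [leRHS]big_nat; apply: ler_sum => m /andP[m1 _].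
have m0 : 0 < m%:R :> R by rewrite ltr0n.
rewrite exprMn mulrC ler_wpM2r ?sqr_ge0// exprVn lef_pV2 ?posrE ?exprn_gt0//; last by lra.
by rewrite ler_sqr ?nnegrE; lra.
Qed.

(** The logarithm telescopes into terms [ln (1 + 1/m)], each within [(c + 1) / m ^+ 2] of
    [1 / (c + m)]. The summable gaps and the term [m = 0] give the two parts of the bound. *)
Lemma sum_bern_ln (R : realType) (th c : R) n : 0 < th -> th <= c -> (0 < n)%N ->
  `|th * ln n%:R - \sum_(m < n) th / (c + m%:R)| <= 1 + 2 * (th * (c + 1)).
Proof.
move=> th0 thc; have c0 : 0 < c by lra.
case: n => [//|n] _.
rewrite -(big_mkord xpredT (fun m => th / (c + m%:R))) big_nat_recl//=.
rewrite -(big_add1 _ _ 0 n.+1 xpredT (fun m => th / (c + m%:R))).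
rewrite -telescope_ln mulr_sumr opprD addrCA -sumrB (le_trans (ler_normD _ _))// lerD//.
  have t0 : 0 <= th / c by rewrite divr_ge0 ?ltW.
  by rewrite addr0 normrN ger0_norm// ler_pdivrMr// mul1r.
have := sum_inv_sqr_le R n; have : 0 <= n%:R^-1 :> R by rewrite invr_ge0.
move=> n0 H; have {H n0}: \sum_(1 <= m < n.+1) (m%:R ^+ 2)^-1 <= 2 :> R by lra.
have t0 : 0 <= th * (c + 1) by nra.
move=> /(ler_wpM2r t0); apply: le_trans.
rewrite mulr_suml (le_trans (ler_norm_sum _ _ _))// big_nat [leRHS]big_nat.
apply: ler_sum => m /andP[m1 _].
have m0 : 0 < m%:R :> R by rewrite ltr0n.
have m1' : 1 <= m%:R :> R by rewrite ler1n.
set x := m%:R in m0 m1' *.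
rewrite -mulrBr normrM (gtr0_norm th0) mulrCA ler_wpM2l ?(ltW th0)//.
have xi0 : 0 < x^-1 by rewrite invr_gt0.
have U : ln (1 + x^-1) <= x^-1 by apply: le_ln1Dx; lra.
have L : x^-1 / (1 + x^-1) <= ln (1 + x^-1) by apply: ln1D_ge; lra.
have L2 : x^-1 - (x ^+ 2)^-1 <= x^-1 / (1 + x^-1).
  rewrite -subr_ge0 (_ : _ - _ = (x ^+ 2 * (x + 1))^-1).
    by rewrite invr_ge0 mulr_ge0 ?sqr_ge0//; lra.
  by field; rewrite !gt_eqF//; lra.
have V : x^-1 - c * (x ^+ 2)^-1 <= (c + x)^-1.
  rewrite -subr_ge0 (_ : _ - _ = c ^+ 2 / (x ^+ 2 * (c + x))).
    by rewrite divr_ge0 ?mulr_ge0 ?sqr_ge0//; lra.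
  by field; rewrite !gt_eqF//; lra.
have V2 : (c + x)^-1 <= x^-1 by rewrite lef_pV2 ?posrE//; lra.
have s0 : 0 < (x ^+ 2)^-1 by rewrite invr_gt0 exprn_gt0.
have W : 0 <= c * (x ^+ 2)^-1 by rewrite mulr_ge0// ltW.
rewrite mulrDr mulr1 [_ * c]mulrC ler_norml; lra.
Qed.

(** * Poisson approximation *)

Definition pois (R : realType) (l : R) (j : nat) : R :=
  expR (- l) * (l ^+ j / j`!%:R).

Lemma pois_gt0 (R : realType) (l : R) j : 0 < l -> 0 < pois l j.
Proof.
by move=> l0; rewrite mulr_gt0 ?expR_gt0// divr_gt0 ?exprn_gt0//.
Qed.

Lemma poisS (R : realType) (l : R) j : j.+1%:R * pois l j.+1 = l * pois l j.
Proof.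
have f0 : j`!%:R != 0 :> R by rewrite pnatr_eq0 -lt0n fact_gt0.
have n0 : j.+1%:R != 0 :> R by rewrite pnatr_eq0.
rewrite /pois exprS factS natrM; move: (j.+1%:R : R) n0 => x x0.
by field; rewrite f0 x0.
Qed.

Lemma pois_sumE (R : realType) (l : R) n :
  \sum_(j < n) pois l j = expR (- l) * series (exp_coeff l) n.
Proof. by rewrite seriesEord /= mulr_sumr. Qed.

Lemma pois_sum_cvg (R : realType) (l : R) :
  (\sum_(j < n) pois l j @[n --> \oo] --> (1 : R))%classic.
Proof.
rewrite -(expRxMexpNx_1 l) mulrC.
under eq_fun do rewrite pois_sumE.
by apply: cvgMr; apply: is_cvg_series_exp_coeff.
Qed.

Lemma pois_sum_le1 (R : realType) (l : R) n : 0 < l ->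
  \sum_(j < n) pois l j <= 1.
Proof.
move=> l0; rewrite pois_sumE -(expRxMexpNx_1 l) mulrC ler_wpM2r ?expR_ge0//.
apply: nondecreasing_cvgn_le; last exact: is_cvg_series_exp_coeff.
by apply: nondecreasing_series => i _ _; apply: exp_coeff_ge0; exact: ltW.
Qed.

Lemma pois_sum_shift_le1 (R : realType) (l : R) b n : 0 < l ->
  \sum_(j < n) pois l (b + j) <= 1.
Proof.
move=> l0; apply: le_trans (pois_sum_le1 (b + n) l0).
rewrite big_split_ord /= lerDr sumr_ge0// => i _.
exact/ltW/pois_gt0.
Qed.

Lemma fact_logconvex i a b : ((i + a)`! * (i + b)`! <= i`! * (i + a + b)`!)%N.
Proof.
elim: b => [|b IH]; first by rewrite !addn0 mulnC.
rewrite !addnS !factS mulnCA [leqRHS]mulnCA leq_mul//.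
by rewrite ltnS -addnA leq_add2l leq_addl.
Qed.

Lemma pois_logconcave (R : realType) (l : R) i a b : 0 < l ->
  pois l i * pois l (i + a + b) <= pois l (i + a) * pois l (i + b).
Proof.
move=> l0; have f0 m : 0 < m`!%:R :> R by rewrite ltr0n fact_gt0.
have E m n : pois l m * pois l n = expR (- l) ^+ 2 * l ^+ (m + n) / (m`!%:R * n`!%:R).
  by rewrite /pois exprD; field; rewrite !gt_eqF.
rewrite !E (_ : (i + a + (i + b) = i + (i + a + b))%N); last by lia.
rewrite ler_wpM2l//; first by rewrite mulr_ge0 ?exprn_ge0 ?expR_ge0 ?(ltW l0).
by rewrite lef_pV2 ?posrE ?mulr_gt0// -!natrM ler_nat fact_logconvex.
Qed.

Definition poisF (R : realType) (l : R) m := \sum_(i < m.+1) pois l i.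

(** Log-concavity bounds [pois l j * pois l i] by [pois l m * pois l (j - m + i)], and shifted
    weights sum to at most 1. *)
Lemma pois_head_le (R : realType) (l : R) m j : 0 < l -> (m <= j)%N ->
  pois l j * poisF l m <= pois l m.
Proof.
move=> l0 mj; rewrite /poisF mulr_sumr.
apply: (@le_trans _ _ (pois l m * \sum_(i < m.+1) pois l (j - m + i))); last first.
  by rewrite ler_piMr ?pois_sum_shift_le1// ltW// pois_gt0.
rewrite mulr_sumr; apply: ler_sum => i _.
have im : (i <= m)%N by rewrite -ltnS.
have := @pois_logconcave _ l i (m - i) (j - m) l0.
rewrite subnKC// subnKC// mulrC [(_ - _ + _)%N]addnC; exact.
Qed.

Lemma pois_tail_le (R : realType) (l : R) m j : 0 < l -> (j <= m)%N ->
  pois l j * (1 - poisF l m) <= pois l m.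
Proof.
move=> l0 jm; have p0 := pois_gt0 j l0.
rewrite mulrC -ler_pdivlMr// lerBlDr.
(* The total mass 1 is replaced by its partial sums, so that only finite pieces of the tail above
   [m] have to be bounded. *)
apply: (ler_cvg_to (pois_sum_cvg l) (cvg_cst _)).
exists m.+1 => // n /= mn; rewrite -(subnKC mn) big_split_ord /= addrC lerD2r.
rewrite ler_pdivlMr// mulrC mulr_sumr.
apply: (@le_trans _ _ (pois l m * \sum_(i < n - m.+1) pois l (j.+1 + i))); last first.
  by rewrite ler_piMr ?pois_sum_shift_le1// ltW// pois_gt0.
rewrite mulr_sumr; apply: ler_sum => i _.
have := @pois_logconcave _ l j (m - j) i.+1 l0.
by rewrite subnKC// !addnS !addSn.
Qed.

(* The solution of the Chen-Stein equation [stein_eq] for the test function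
   [m |-> (m == j)%:R]. *)
Definition stein (R : realType) (l : R) (j m : nat) : R :=
  if m is m'.+1 then
    ((j <= m')%:R * pois l j - pois l j * poisF l m') / (l * pois l m')
  else 0.

(** By [poisS] the two quotients share the denominator [pois l m], and their numerators differ by
    the jump of the indicator at [j] and one term of [poisF]. The value 0 chosen at [m = 0] is
    multiplied by 0. *)
Lemma stein_eq (R : realType) (l : R) j m : 0 < l ->
  l * stein l j m.+1 - m%:R * stein l j m = (m == j)%:R - pois l j.
Proof.
move=> l0; have p0 i : pois l i != 0 by rewrite gt_eqF// pois_gt0.
have l0' : l != 0 by rewrite gt_eqF.
case: m => [|m].
  rewrite mul0r subr0 /= /poisF big_ord1 leqn0 [0%N == j]eq_sym.
  case: eqP => [->|_] /=; field; rewrite ?p0//.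
rewrite /= /poisF [X in _ - pois l j * X]big_ord_recr /=; set F := \sum_(_ < _) _.
have -> : m.+1%:R * (((j <= m)%:R * pois l j - pois l j * F) / (l * pois l m)) =
   ((j <= m)%:R * pois l j - pois l j * F) / pois l m.+1.
  have -> : l * pois l m = m.+1%:R * pois l m.+1 by rewrite poisS.
  have n0 : m.+1%:R != 0 :> R by rewrite pnatr_eq0.
  by move: (m.+1%:R : R) n0 => x x0; field; rewrite p0 x0.
rewrite invfM [_ * (l^-1 * _)]mulrCA mulVKf//.
rewrite -mulrBl.
rewrite [(j <= m.+1)%N]leq_eqVlt ltnS [(j == m.+1)%N]eq_sym.
have [<-|jm] := eqVneq m.+1 j; first by rewrite ltnn /=; field; rewrite p0.
by rewrite /=; field; rewrite p0.
Qed.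

(** At [m.+1] the numerator is [pois l j] times the tail mass if [j <= m], and minus [pois l j]
    times the head mass otherwise; either is at most [pois l m] in absolute value. *)
Lemma stein_le (R : realType) (l : R) j m : 0 < l -> `|stein l j m| <= l^-1.
Proof.
move=> l0; case: m => [|m] /=; first by rewrite normr0 invr_ge0 ltW.
have p0 := pois_gt0 m l0; have pj := pois_gt0 j l0.
rewrite normrM normfV (gtr0_norm (mulr_gt0 l0 p0)) (ler_pdivrMr _ _ (mulr_gt0 l0 p0)).
rewrite mulKf ?gt_eqF//; case: leqP => [jm|mj].
  rewrite mul1r -{1}[pois l j]mulr1 -mulrBr ger0_norm ?pois_tail_le//.
  by rewrite mulr_ge0 ?(ltW pj)// subr_ge0 pois_sum_le1.
rewrite mul0r sub0r normrN ger0_norm; first exact/pois_head_le/ltnW.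
by rewrite mulr_ge0 ?(ltW pj)// sumr_ge0// => i _; exact/ltW/pois_gt0.
Qed.

(** Taking expectations in [stein_eq] splits the error into the mismatch of means [(l - mu) * G] and
    the defect bounded by [bernE_stein_le]. *)
Lemma bernE_pois_le (R : realType) (p : nat -> R) (l : R) n j :
  (forall i, 0 <= p i <= 1) -> 0 < l ->
  `|bernE p n (fun m => (m == j)%:R) - pois l j| <=
  (`|l - \sum_(i < n) p i| + 2 * \sum_(i < n) p i ^+ 2) / l.
Proof.
move=> p01 l0.
have H := bernE_stein_le n p01 (fun m => stein_le j m l0).
set mu := \sum_(i < n) p i in H *; set G := bernE p n _ in H.
set W := bernE p n _ in H.
have -> : bernE p n (fun m => (m == j)%:R) - pois l j = (l - mu) * G + (mu * G - W).
  have : bernE p n (fun m => (m == j)%:R + (-1) * pois l j) =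
      bernE p n (fun m => l * stein l j m.+1 + (-1) * (m%:R * stein l j m)).
    by apply: bernE_ext => m; rewrite !mulN1r stein_eq.
  rewrite !bernED bernE_cst !bernEZ -/G -/W; lra.
have HG : `|G| <= l^-1 by apply: bernE_norm_le => // m; apply: stein_le.
rewrite (le_trans (ler_normD _ _))// [leRHS]mulrDl lerD//.
  by rewrite normrM ler_wpM2l.
by rewrite mulrAC.
Qed.

(** * Wallis' product and Stirling's formula *)

Lemma derive_continuous_within (R : realType) (f df : R -> R) (a b : R) :
  (forall x, x \in `[a, b] -> is_derive x 1 f (df x)) ->
  {within `[a, b], continuous f}%classic.
Proof.
move=> fd; apply: derivable_within_continuous => x xab.
by have [] := fd x xab.
Qed.

Lemma MVT_closed (R : realType) (f df : R -> R) (a b : R) : a <= b ->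
  (forall x, a <= x <= b -> is_derive x 1 f (df x)) ->
  exists2 c, a <= c <= b & f b - f a = df c * (b - a).
Proof.
move=> ab fd; have fd' x : x \in `[a, b] -> is_derive x 1 f (df x).
  by rewrite in_itv /=; apply: fd.
have [c] := MVT_segment ab (fun x xab => fd' x (subset_itv_oo_cc xab))
  (derive_continuous_within fd').
by rewrite in_itv /= => cab E; exists c.
Qed.

(** The difference has derivative [y ^+ 2 / ((1 + y) * (2 + y) ^+ 2)]. At [x = 1/n] the approximant
    is [1 / (n + 1/2)], which suits the increments of Stirling's formula. *)
Lemma ln1D_pade (R : realType) (x : R) : 0 <= x ->
  0 <= ln (1 + x) - 2 * x / (2 + x) <= x ^+ 3 / 4.
Proof.
move=> x0.
pose f := fun y : R => ln (1 + y) - 2 * y / (2 + y).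
pose df := fun y : R => y ^+ 2 / ((1 + y) * (2 + y) ^+ 2).
have fd y : 0 <= y <= x -> is_derive y 1 f (df y).
  move=> /andP[y0 _].
  have y1 : 0 < 1 + y by lra.
  have y2 : 2 + y != 0 by rewrite gt_eqF//; lra.
  have D1 : is_derive y 1 (fun y : R => ln (1 + y)) (1 + y)^-1.
    have := is_derive1_ln y1 => D.
    by apply: is_derive_eq; rewrite ?scaler1 ?add0r ?mulr1.
  have D2 : is_derive y 1 (fun y : R => (2 + y)^-1) (- (2 + y) ^- 2).
    by apply: is_derive_eq; rewrite add0r ?scaler1 ?mulr1.
  apply: is_derive_eq; rewrite /df /GRing.scale /=; field.
  by rewrite y2 gt_eqF.
have [c /andP[c0 cx]] := MVT_closed x0 fd.
rewrite {1 2}/f addr0 ln1 mulr0 mul0r !subr0 => ->.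
have d0 : 0 < (1 + c) * (2 + c) ^+ 2 by rewrite mulr_gt0 ?exprn_gt0//; lra.
have dc : 0 <= df c <= x ^+ 2 / 4.
  rewrite /df divr_ge0 ?sqr_ge0 ?(ltW d0)//= ler_pdivrMr// mulrAC ler_pdivlMr//.
  have : 4 <= (1 + c) * (2 + c) ^+ 2 by nra.
  have : c ^+ 2 <= x ^+ 2 by rewrite ler_sqr ?nnegrE.
  by move=> h1 h2; apply: ler_pM => //; rewrite sqr_ge0.
have /andP[d1 d2] := dc.
rewrite mulr_ge0//= (_ : x ^+ 3 / 4 = x ^+ 2 / 4 * x); last by ring.
by rewrite ler_wpM2r.
Qed.

(* Antiderivatives of [sin ^+ n], obtained from the reduction formula; they avoid
   any integration theory in Wallis' product. *)
Fixpoint sin_prim (R : realType) n (x : R) : R :=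
  match n with
  | 0 => x
  | 1 => - cos x
  | m.+2 => (m.+1%:R * sin_prim m x - sin x ^+ m.+1 * cos x) / m.+2%:R
  end.

Lemma is_derive_sin_prim (R : realType) n (x : R) :
  is_derive x 1 (@sin_prim R n) (sin x ^+ n).
Proof.
(* Two consecutive cases are carried along because the recursion descends by two. *)
suff : is_derive x 1 (@sin_prim R n) (sin x ^+ n) /\
       is_derive x 1 (@sin_prim R n.+1) (sin x ^+ n.+1) by case.
elim: n => [|n [IH1 IH2]].
  split; first by rewrite expr0; exact: is_derive_id.
  by apply: is_derive_eq; rewrite opprK expr1.
split => //=.
have D : is_derive x 1 (fun x : R => sin x ^+ n.+1) (n.+1%:R * sin x ^+ n * cos x).
  have := @is_deriveX R R (@sin R) n.+1 x 1 (cos x) (is_derive_sin x).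
  by rewrite exprfctE.
apply: is_derive_eq; rewrite /GRing.scale /=.
have n0 : n.+2%:R != 0 :> R by rewrite pnatr_eq0.
rewrite !mulr0 add0r; apply: (mulfI n0); rewrite mulVKf// -[n.+2%:R]natr1 !exprS.
have cs : cos x * cos x = 1 - sin x * sin x.
  by have := cos2Dsin2 x; rewrite !expr2 => <-; ring.
rewrite (_ : cos x * (_ * cos x) = n.+1%:R * sin x ^+ n * (cos x * cos x)); last by ring.
by rewrite cs; ring.
Qed.

(** Wallis' integral of [sin x ^+ n] from 0 to [pi / 2]. *)
Definition wallis (R : realType) n : R := sin_prim n (pi / 2) - sin_prim n 0.

Lemma wallis0 (R : realType) : wallis R 0 = pi / 2.
Proof. by rewrite /wallis /= subr0. Qed.

Lemma wallis1 (R : realType) : wallis R 1 = 1.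
Proof. by rewrite /wallis /= cos_pihalf cos0 oppr0 opprK add0r. Qed.

Lemma wallisSS (R : realType) n :
  n.+2%:R * wallis R n.+2 = n.+1%:R * wallis R n.
Proof.
rewrite /wallis /= cos_pihalf sin0 expr0n /= mulr0 mul0r !subr0 -mulrBl -mulrBr.
by rewrite mulrC divfK// pnatr_eq0.
Qed.

Lemma wallis_gt0 (R : realType) n : 0 < wallis R n.
Proof.
suff : 0 < wallis R n /\ 0 < wallis R n.+1 by case.
elim: n => [|n [IH1 IH2]]; first by rewrite wallis0 wallis1 divr_gt0// pi_gt0.
split=> //; rewrite -(pmulr_rgt0 _ (ltr0Sn R n.+1)) wallisSS.
by rewrite mulr_gt0// ltr0n.
Qed.

(** The mean value theorem for the difference of the antiderivatives replaces monotonicity of the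
    integral. *)
Lemma wallisS_le (R : realType) n : wallis R n.+1 <= wallis R n.
Proof.
have pi0 : 0 <= pi / 2 :> R by rewrite divr_ge0// ltW// pi_gt0.
pose f (x : R) := sin_prim n x - sin_prim n.+1 x.
have fd x : 0 <= x <= pi / 2 -> is_derive x 1 f (sin x ^+ n - sin x ^+ n.+1).
  move=> _; apply: (@is_deriveB _ _ _ (@sin_prim R n) (@sin_prim R n.+1));
  exact: is_derive_sin_prim.
have [c /andP[c0 c1]] := MVT_closed pi0 fd.
rewrite /f subr0 => E.
have s0 : 0 <= sin c.
  by apply: sin_ge0_pi; rewrite c0 (le_trans c1)// ler_pdivrMr//; have := pi_gt0 R; lra.
have : 0 <= (sin c ^+ n - sin c ^+ n.+1) * (pi / 2).
  by rewrite mulr_ge0// exprS -{1}[_ ^+ n]mul1r -mulrBl mulr_ge0 ?exprn_ge0// subr_ge0 sin_le1.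
rewrite -E /wallis; lra.
Qed.

(** By [wallisSS] the product does not depend on [n]. *)
Lemma wallis_prod (R : realType) n :
  n.+1%:R * wallis R n.+1 * wallis R n = pi / 2.
Proof.
elim: n => [|n IH]; first by rewrite wallis0 wallis1 !mul1r.
by rewrite wallisSS mulrAC.
Qed.

Lemma wallis_even (R : realType) n :
  wallis R n.*2 = pi / 2 * ((n.*2)`!%:R / (4 ^+ n * n`!%:R ^+ 2)).
Proof.
elim: n => [|n IH]; first by rewrite wallis0 double0 expr0 fact0; field.
have n0 : n.+1%:R != 0 :> R by rewrite pnatr_eq0.
have f0 : n`!%:R != 0 :> R by rewrite pnatr_eq0 -lt0n fact_gt0.
have d0 : n.*2.+2%:R != 0 :> R by rewrite pnatr_eq0.
have e0 : 4 ^+ n != 0 :> R by rewrite expf_eq0 pnatr_eq0 andbF.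
apply: (mulfI d0); rewrite doubleS wallisSS IH !factS !natrM (exprS 4 n).
have -> : n.*2.+2%:R = 2 * n.+1%:R :> R by rewrite -doubleS -mul2n natrM.
move: (n.+1%:R : R) n0 (4 ^+ n : R) e0 => y y0 e e0.
by field; rewrite f0 e0 y0.
Qed.

(** Replacing one factor in [wallis_prod] by its neighbour, using monotonicity, bounds
    [wallis R n.*2 ^+ 2] on both sides. *)
Lemma central_binomial_bounds (R : realType) n :
  let b := (n.*2)`!%:R / (4 ^+ n * n`!%:R ^+ 2) : R in
  2 <= n.*2.+1%:R * (pi * b ^+ 2) /\ n.*2%:R * (pi * b ^+ 2) <= 2.
Proof.
move=> b; have W0 := wallis_gt0 R; have p0 := pi_gt0 R.
have E : wallis R n.*2 ^+ 2 = pi / 4 * (pi * b ^+ 2).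
  by rewrite wallis_even -/b; field.
have L : n.*2.+1%:R * wallis R n.*2 ^+ 2 >= pi / 2.
  rewrite -(wallis_prod R n.*2) expr2 mulrA; apply: ler_wpM2r; first exact: ltW.
  by apply: ler_wpM2l => //; apply: wallisS_le.
have U : n.*2%:R * wallis R n.*2 ^+ 2 <= pi / 2.
  case: {E L} n.*2 => [|m]; first by rewrite mul0r divr_ge0// ltW.
  rewrite -(wallis_prod R m) expr2 mulrA; apply: ler_wpM2l; last exact: wallisS_le.
  by rewrite mulr_ge0// ltW.
rewrite E in L U; split.
- rewrite -(ler_pM2l (_ : 0 < pi / 4)) ?divr_gt0//; apply: le_trans (le_trans L _).
    by rewrite le_eqVlt; apply/orP; left; apply/eqP; field.
  by rewrite mulrCA.
- rewrite -(ler_pM2l (_ : 0 < pi / 4)) ?divr_gt0// mulrCA (le_trans U)//.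
  by rewrite le_eqVlt; apply/orP; left; apply/eqP; field.
Qed.

(** For positive [n], the logarithm of [n! / (n^(n + 1/2) * exp(-n))]. *)
Definition stirling_err (R : realType) (n : nat) : R :=
  ln n`!%:R - (n%:R + 1 / 2) * ln n%:R + n%:R.

Lemma stirling_err_step (R : realType) n : (0 < n)%N ->
  0 <= stirling_err R n - stirling_err R n.+1 <= (n%:R ^+ 2)^-1.
Proof.
move=> n0; have x0 : 0 < n%:R :> R by rewrite ltr0n.
have x1 : 1 <= n%:R :> R by rewrite ler1n.
have E : ln n.+1%:R = ln n%:R + ln (1 + n%:R^-1) :> R.
  rewrite -lnM ?posrE ?ltr_wpDr// ?invr_ge0//.
  by rewrite mulrDr mulr1 divff ?gt_eqF// natr1.
have -> : stirling_err R n - stirling_err R n.+1 =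
    (n%:R + 1 / 2) * ln (1 + n%:R^-1) - 1.
  rewrite /stirling_err factS natrM lnM ?posrE ?ltr0n ?fact_gt0// E -natr1; ring.
set x : R := n%:R in x0 x1 *.
have xi0 : 0 <= x^-1 by rewrite invr_ge0 ltW.
have /andP[P1 P2] := ln1D_pade xi0.
(* This approximant cancels the constant 1 exactly and leaves [(x + 1 / 2)] times a cubic error in
   [x^-1]. *)
have E2 : 2 * x^-1 / (2 + x^-1) = (x + 1 / 2)^-1.
  by field; rewrite !gt_eqF//; lra.
rewrite E2 in P1 P2.
have y0 : 0 < x + 1 / 2 by lra.
have -> : (x + 1 / 2) * ln (1 + x^-1) - 1 = (x + 1 / 2) * (ln (1 + x^-1) - (x + 1 / 2)^-1).
  by rewrite mulrBr divff// gt_eqF.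
rewrite mulr_ge0 ?(ltW y0)//=.
apply: (le_trans (ler_wpM2l (ltW y0) P2)).
rewrite -subr_ge0 (_ : _ - _ = (3 / 4 * x - 1 / 8) / x ^+ 3).
  by rewrite divr_ge0 ?exprn_ge0//; lra.
by field; rewrite gt_eqF.
Qed.

Lemma stirling_err_is_cvg (R : realType) :
  cvgn (fun n => stirling_err R n.+1).
Proof.
apply: nonincreasing_is_cvgn.
  apply/nonincreasing_seqP => n.
  by have /andP[] := @stirling_err_step R n.+1 isT; rewrite subr_ge0.
exists (stirling_err R 1 - 2) => _ [n _ <-].
have : stirling_err R 1 - \sum_(1 <= m < n.+1) (m%:R ^+ 2)^-1 <= stirling_err R n.+1.
  elim: n => [|n IH]; first by rewrite big_geq// subr0.
  rewrite big_nat_recr//=; have /andP[_ H] := @stirling_err_step R n.+1 isT.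
  by rewrite opprD addrA lerBlDr (le_trans IH)// addrC -lerBlDr.
have := sum_inv_sqr_le R n; have : 0 <= n%:R^-1 :> R by rewrite invr_ge0.
lra.
Qed.

(* The combination is [ln (n b^2 / 2)] with [b = 'C(2n, n) / 4^n], to which the
   Wallis bounds apply. *)
Lemma stirling_err_double (R : realType) n : (0 < n)%N ->
  - ln (2 * pi) - n%:R^-1 <=
  2 * (stirling_err R n.*2 - 2 * stirling_err R n) <= - ln (2 * pi).
Proof.
move=> n0; have x0 : 0 < n%:R :> R by rewrite ltr0n.
have p0 := pi_gt0 R.
have [] := central_binomial_bounds R n.
set b : R := _ / _ => L U.
have f0 m : 0 < m`!%:R :> R by rewrite ltr0n fact_gt0.
have e0 : 0 < 4 ^+ n :> R by rewrite exprn_gt0.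
have b0 : 0 < b by rewrite divr_gt0// mulr_gt0// exprn_gt0.
have E : 2 * (stirling_err R n.*2 - 2 * stirling_err R n) = ln (n%:R * b ^+ 2 / 2).
  rewrite ln_div ?posrE ?mulr_gt0 ?exprn_gt0// lnM ?posrE ?exprn_gt0// lnXn//.
  rewrite /b ln_div ?posrE ?mulr_gt0 ?exprn_gt0// lnM ?posrE ?exprn_gt0// !lnXn//.
  rewrite /stirling_err -mul2n natrM lnM ?posrE//.
  have -> : ln 4 = 2 * ln 2 :> R.
    by rewrite (_ : 4 = 2 * 2 :> R) ?lnM ?posrE//; ring.
  by rewrite -(mulr_natr (2 * ln 2) n); field.
rewrite E -[in X in _ <= _ <= X]lnV ?posrE ?mulr_gt0//.
rewrite -[n.*2.+1%:R]natr1 -mul2n natrM in L; rewrite -mul2n natrM in U.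
set x : R := n%:R in x0 L U E *.
have q0 : 0 < x * b ^+ 2 / 2 by rewrite divr_gt0 ?mulr_gt0 ?exprn_gt0.
apply/andP; split; last first.
  rewrite ler_ln ?posrE ?invr_gt0 ?mulr_gt0// -[leRHS]mul1r ler_pdivlMr ?mulr_gt0//.
  lra.
have z0 : 0 < 1 + x^-1 by rewrite ltr_wpDr// invr_ge0 ltW.
have : ln (1 + x^-1) <= x^-1.
  have xi0 : 0 < x^-1 by rewrite invr_gt0.
  by apply: le_ln1Dx; lra.
have : - ln (2 * pi) - ln (1 + x^-1) <= ln (x * b ^+ 2 / 2).
  rewrite -opprD -lnM ?posrE ?mulr_gt0// -lnV ?posrE ?mulr_gt0//.
  rewrite ler_ln ?posrE ?invr_gt0 ?mulr_gt0//.
  rewrite -[leLHS]mul1r ler_pdivrMr ?mulr_gt0//.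
  rewrite (_ : x * b ^+ 2 / 2 * (2 * pi * (1 + x^-1)) = (x + 1) * (pi * b ^+ 2)).
    have : 0 <= pi * b ^+ 2 by rewrite mulr_ge0 ?sqr_ge0// ltW.
    nra.
  by field; rewrite gt_eqF.
lra.
Qed.

(** If [S] is the limit, the combination of [stirling_err_double] tends both to [- 2 * S] and to
    [- ln (2 * pi)]. *)
Lemma stirling_cvg (R : realType) :
  (stirling_err R n @[n --> \oo] --> ln (2 * pi) / 2)%classic.
Proof.
have cu := @stirling_err_is_cvg R.
pose S : R := limn (fun n => stirling_err R n.+1).
have cS : (stirling_err R n @[n --> \oo] --> S)%classic.
  by rewrite -cvg_shiftS; exact: cu.
suff -> : ln (2 * pi) / 2 = S by [].
pose f n := 2 * (stirling_err R n.+1.*2 - 2 * stirling_err R n.+1).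
have f1 : (f n @[n --> \oo] --> 2 * (S - 2 * S))%classic.
  apply: cvgMr; apply: cvgB; last by apply: cvgMr; exact: cu.
  apply: (@cvg_comp _ _ _ (fun n => n.+1.*2) (stirling_err R) _ \oo%classic) => //.
  apply/cvgnyPge => A; exists A => // n /= An.
  by rewrite -addnn (leq_trans An)// (leq_trans (leqnSn n))// leq_addr.
have f2 : (f n @[n --> \oo] --> - ln (2 * pi))%classic.
  apply: (@squeeze_cvgr _ _ _ _ (fun n => - ln (2 * pi) - n.+1%:R^-1) (fun=> - ln (2 * pi))).
  - by apply: nearW => n; apply: stirling_err_double.
  - rewrite -[X in (_ --> X)%classic]subr0; apply: cvgB; first exact: cvg_cst.
    exact: cvg_harmonic.
  - exact: cvg_cst.
have E : 2 * (S - 2 * S) = - ln (2 * pi) by exact: (cvg_unique (@norm_hausdorff _ _) f1 f2).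
lra.
Qed.

(** * Local limit theorem for the Poisson law *)

Lemma pois_ratio_right (R : realType) (l : R) i t : 0 < l -> l <= i%:R ->
  pois l (i + t) <= pois l i.
Proof.
move=> l0 li; elim: t => [|t IH]; first by rewrite addn0.
apply: le_trans IH; rewrite addnS.
have x0 : 0 < (i + t).+1%:R :> R by rewrite ltr0n.
rewrite -(ler_pM2l x0) poisS ler_wpM2r ?(ltW (pois_gt0 _ l0))//.
by rewrite (le_trans li)// ler_nat -addnS leq_addr.
Qed.

Lemma pois_ratio_left (R : realType) (l : R) i t : 0 < l -> (i + t)%:R <= l ->
  pois l i <= pois l (i + t).
Proof.
move=> l0; elim: t => [|t IH]; first by rewrite addn0.
rewrite addnS => li; apply: le_trans (IH _) _.
  by rewrite (le_trans _ li)// ler_nat.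
have x0 : 0 < (i + t).+1%:R :> R by rewrite ltr0n.
by rewrite -(ler_pM2l x0) poisS ler_wpM2r ?(ltW (pois_gt0 _ l0)).
Qed.

(* All Poisson weights between [j] and [l] are at least [pois l j]. *)
Lemma pois_dist_le1 (R : realType) (l : R) (j : nat) : 0 < l ->
  `|j%:R - l| * pois l j <= 1.
Proof.
move=> l0; have pj := pois_gt0 j l0.
(* If [N >= x] consecutive weights are all at least [pois l j], then [x * pois l j] is at most the
   total mass. *)
have cnt (N b : nat) (x : R) : x <= N%:R ->
    (forall t, (t < N)%N -> pois l j <= pois l (b + t)) -> x * pois l j <= 1.
  move=> xN H; apply: le_trans (pois_sum_shift_le1 b N l0).
  apply: (@le_trans _ _ (\sum_(i < N) pois l j)).
    by rewrite sumr_const card_ord -mulr_natl ler_wpM2r// ltW.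
  by apply: ler_sum => i _; apply: H.
have [lj|jl] := leP l j%:R.
  have d0 : 0 <= j%:R - l by rewrite subr_ge0.
  rewrite ger0_norm//; have /andP[N1 N2] := truncn_itv d0.
  set N := Num.trunc _ in N1 N2.
  have Nj : (N <= j)%N by rewrite -(ler_nat R); lra.
  (* The [N.+1] indices run from [j - N] to [j] and stay above [l]; truncation guarantees only that
     the distance is below [N.+1]. *)
  apply: (cnt N.+1 (j - N)%N _ (ltW N2)) => t tN.
  have -> : j = (j - N + t + (N - t))%N by lia.
  rewrite (_ : (j - N + t + (N - t) - N + t)%N = (j - N + t)%N); last by lia.
  apply: pois_ratio_right => //; rewrite natrD natrB//.
  have : 0 <= t%:R :> R by [].
  lra.
have d0 : 0 <= l - j%:R by rewrite subr_ge0 ltW.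
rewrite distrC ger0_norm//; have /andP[N1 N2] := truncn_itv d0.
set N := Num.trunc _ in N1 N2.
apply: (cnt N.+1 j _ (ltW N2)) => t tN.
apply: pois_ratio_left => //; rewrite natrD.
have : t%:R <= N%:R :> R by rewrite ler_nat.
lra.
Qed.

Lemma ln1D_quad (R : realType) (y : R) : - (1 / 2) <= y ->
  `|ln (1 + y) - y| <= 2 * y ^+ 2.
Proof.
move=> y1.
have U : ln (1 + y) <= y by apply: le_ln1Dx; lra.
have L : y / (1 + y) <= ln (1 + y) by apply: ln1D_ge; lra.
have : y - 2 * y ^+ 2 <= y / (1 + y).
  have d0 : 0 < 1 + y by lra.
  rewrite -subr_ge0 (_ : _ - _ = y ^+ 2 * (1 + 2 * y) / (1 + y)).
    by apply: divr_ge0; last lra; apply: mulr_ge0; [exact: sqr_ge0|lra].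
  by field; rewrite gt_eqF.
move=> H; have H2 := le_trans H L; have := sqr_ge0 y.
by rewrite ler_norml => y2; apply/andP; split; lra.
Qed.

(** The left side has derivative [ln (1 + y) - y], which is quadratically small, and vanishes at 0;
    the mean value theorem adds one factor [u]. *)
Lemma entropy_quad (R : realType) (u : R) : `|u| <= 1 / 2 ->
  `|(1 + u) * ln (1 + u) - u - u ^+ 2 / 2| <= 2 * `|u| ^+ 3.
Proof.
move=> u12; have [u1 u2] := ler_normlP _ _ u12.
pose f := fun y : R => (1 + y) * ln (1 + y) - y - y ^+ 2 / 2.
have fd (y : R) : - (1 / 2) <= y -> is_derive y 1 f (ln (1 + y) - y).
  move=> y1; have y0 : 0 < 1 + y by lra.
  have D1 : is_derive y 1 (fun y : R => ln (1 + y)) (1 + y)^-1.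
    have := is_derive1_ln y0 => D.
    by apply: is_derive_eq; rewrite ?scaler1 ?add0r ?mulr1.
  have D2 : is_derive y 1 (fun y : R => y ^+ 2) (2 * y).
    have := @is_deriveX R R id 2 y 1 1 (is_derive_id _ _).
    by rewrite exprfctE /= expr1 /GRing.scale /= mulr1.
  by apply: is_derive_eq; rewrite /GRing.scale /=; field; rewrite gt_eqF.
have f0 : f 0 = 0 by rewrite /f addr0 ln1 mulr0 expr0n /= mul0r !subr0.
have B c : `|c| <= `|u| -> - (1 / 2) <= c -> `|(ln (1 + c) - c) * u| <= 2 * `|u| ^+ 3.
  move=> cu c1; rewrite normrM exprSr mulrA ler_wpM2r//.
  rewrite (le_trans (ln1D_quad c1))// ler_wpM2l// -normrX -[leLHS]ger0_norm ?sqr_ge0//.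
  by rewrite normrX normrX lerXn2r ?nnegrE.
have [u0|u0] := leP 0 u.
  have [|c /andP[c0 c1]] := @MVT_closed R f (fun y => ln (1 + y) - y) 0 u u0.
    by move=> y /andP[y0 _]; apply: fd; lra.
  rewrite f0 !subr0 -/(f u) => ->; apply: B; last by lra.
  by rewrite !ger0_norm.
have [|c /andP[c0 c1]] := @MVT_closed R f (fun y => ln (1 + y) - y) u 0 (ltW u0).
  by move=> y /andP[y0 _]; apply: fd; lra.
rewrite f0 !sub0r => E; rewrite -/(f u) -normrN E mulrN normrN; apply: B; last by lra.
by rewrite !ler0_norm ?lerN2// ltW.
Qed.

Lemma expR_sub1_le (R : realType) (t : R) : `|t| <= 1 / 2 ->
  `|expR t - 1| <= 2 * `|t|.
Proof.
move=> t12; have [t1 t2] := ler_normlP _ _ t12.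
have L := expR_ge1Dx t; have := expR_ge1Dx (- t).
have e0 := expR_gt0 t; rewrite expRN => H.
have : expR t * (1 - t) <= 1.
  by have := ler_wpM2l (ltW e0) H; rewrite divff ?gt_eqF.
move=> H2; have [t0|t0] := leP 0 t; rewrite ler_norml.
  rewrite (ger0_norm t0); apply/andP; split; nra.
rewrite (ltr0_norm t0); apply/andP; split; nra.
Qed.

(** Isolates the Gaussian exponent from three corrections: the cubic entropy remainder, the
    replacement of [sqrt l] by [sqrt j], and the error in Stirling's formula. *)
Lemma pois_exp_form (R : realType) (l : R) (j : nat) : 0 < l -> (0 < j)%N ->
  let u := (j%:R - l) / l in
  Num.sqrt (2 * pi) * Num.sqrt l * pois l j =
  expR (- (l * u ^+ 2 / 2) +
    (- (l * ((1 + u) * ln (1 + u) - u - u ^+ 2 / 2)) - ln (1 + u) / 2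
      - (stirling_err R j - ln (2 * pi) / 2))).
Proof.
move=> l0 j0 u; have p0 := pi_gt0 R.
have x0 : 0 < j%:R :> R by rewrite ltr0n.
have f0 : 0 < j`!%:R :> R by rewrite ltr0n fact_gt0.
have p20 : 0 < 2 * pi :> R by rewrite mulr_gt0.
have jE : 1 + u = j%:R / l by rewrite /u; field; rewrite gt_eqF.
have lnj : ln j%:R = ln l + ln (1 + u).
  by rewrite jE ln_div ?posrE// addrC subrK.
have sqE (a : R) : 0 < a -> Num.sqrt a = expR (ln a / 2).
  move=> a0; rewrite -[in LHS](lnK (_ : a \is Num.pos)) ?posrE//.
  have -> : expR (ln a) = expR (ln a / 2) ^+ 2.
    by rewrite -expRM_natl; congr expR; field.
  by rewrite sqrtr_sqr ger0_norm ?expR_ge0.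
have pE : pois l j = expR (- l + (j%:R * ln l - ln j`!%:R)).
  rewrite /pois expRD expRB expRM_natl !lnK ?posrE//.
rewrite !sqE// pE -!expRD; congr expR.
rewrite /stirling_err lnj.
have -> : j%:R = l + l * u by rewrite /u; field; rewrite gt_eqF.
by field.
Qed.

Lemma pois_bulk (R : realType) (K e : R) : 1 <= K -> 0 < e ->
  exists L : R, forall l, L <= l -> forall j : nat,
    `|j%:R - l| <= K * Num.sqrt l ->
    `|Num.sqrt (2 * pi) * Num.sqrt l * pois l j
      - expR (- ((j%:R - l) ^+ 2 / (2 * l)))| <= e.
Proof.
move=> K1 e0.
(* The correction [tau] will satisfy [|tau| <= 2 * e1 <= 1 / 2], hence
   [|expR tau - 1| <= 4 * e1 <= e]. *)
pose e1 := Num.min (e / 4) (1 / 4).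
have e10 : 0 < e1 by rewrite lt_min !divr_gt0.
have e1e : e1 <= e / 4 by rewrite ge_min lexx.
have e14 : e1 <= 1 / 4 by rewrite ge_min lexx orbT.
have /cvgrPdist_le /(_ e1 e10) [J _ HJ] := @stirling_cvg R.
(* With [|u| <= K / sqrt l], the entropy remainder contributes [2 * K ^+ 3 / sqrt l] and the half
   logarithm at most [K / sqrt l]. *)
pose C := 2 * K ^+ 3 + K.
have K3 : 0 <= K ^+ 3 by rewrite exprn_ge0; lra.
pose B := 2 * K + C / e1 + 1.
have Ce : 0 <= C / e1 by rewrite divr_ge0 ?(ltW e10)// /C; lra.
(* The square gives [sqrt l >= B], hence [K / sqrt l <= 1 / 2] and [C / sqrt l <= e1]; the other
   term makes [j >= l / 2] exceed the threshold [J] of Stirling's formula. *)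
exists (B ^+ 2 + 2 * J.+1%:R) => l Ll j jl.
have B1 : 1 <= B by rewrite /B; lra.
have JB : 0 < J.+1%:R :> R by rewrite ltr0n.
have l0 : 0 < l by have := sqr_ge0 B; lra.
set w := Num.sqrt l.
have w2 : w ^+ 2 = l by rewrite sqr_sqrtr ?ltW.
have wB : B <= w.
  by rewrite -(@ler_sqr _ B w) ?nnegrE ?sqrtr_ge0// ?w2; lra.
have w0 : 0 < w by lra.
pose u := (j%:R - l) / l.
have uw : `|u| <= K / w.
  rewrite /u normrM normfV (gtr0_norm l0) ler_pdivrMr// (le_trans jl)//.
  by rewrite -/w -w2 expr2 mulrA divfK ?gt_eqF.
have Kw : K / w <= 1 / 2 by rewrite ler_pdivrMr//; move: wB; rewrite /B; lra.
have Cw : C / w <= e1.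
  by rewrite ler_pdivrMr// mulrC -ler_pdivrMr//; move: wB; rewrite /B; lra.
have u12 := le_trans uw Kw.
have [u1 u2] := ler_normlP _ _ u12.
have jE : j%:R = l * (1 + u) by rewrite /u; field; rewrite gt_eqF.
have jJ : (J.+1 <= j)%N.
  by rewrite -(ler_nat R) jE; have := sqr_ge0 B; nra.
rewrite pois_exp_form//; last by apply: leq_trans jJ.
rewrite -/u; set tau := (_ - ln (1 + u) / 2 - _).
have -> : (j%:R - l) ^+ 2 / (2 * l) = l * u ^+ 2 / 2.
  by rewrite /u; field; rewrite gt_eqF.
have T : `|tau| <= 2 * e1.
  rewrite /tau (le_trans (ler_normB _ _))//.
  have H1 : `|stirling_err R j - ln (2 * pi) / 2| <= e1.
    by rewrite distrC; apply: HJ => /=; apply: leq_trans jJ.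
  suff H2 : `|- (l * ((1 + u) * ln (1 + u) - u - u ^+ 2 / 2)) - ln (1 + u) / 2| <= C / w.
    by lra.
  rewrite (le_trans (ler_normB _ _))// normrN normrM (gtr0_norm l0).
  have -> : C / w = w ^+ 2 * (2 * (K / w) ^+ 3) + K / w.
    by rewrite /C; field; rewrite gt_eqF.
  rewrite w2; apply: lerD.
    rewrite ler_wpM2l ?(ltW l0)// (le_trans (entropy_quad u12))//.
    by rewrite ler_wpM2l// lerXn2r ?nnegrE// divr_ge0; lra.
  rewrite normrM [`|2^-1|]ger0_norm; last by rewrite invr_ge0.
  rewrite ler_pdivrMr// (le_trans _ (ler_wpM2r _ uw))//.
  have u12' : - (1 / 2) <= u by lra.
  have := ln1D_quad u12'; have := ler_normD (ln (1 + u) - u) u; rewrite subrK => A1 A2.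
  have : 2 * u ^+ 2 <= `|u|.
    rewrite -[u ^+ 2]ger0_norm ?sqr_ge0// normrX; have := normr_ge0 u; nra.
  lra.
rewrite expRD -[X in _ - X]mulr1 -mulrBr normrM ger0_norm ?expR_ge0//.
have T2 : `|tau| <= 1 / 2 by lra.
have := expR_sub1_le T2 => T3.
have E1 : expR (- (l * u ^+ 2 / 2)) <= 1.
  rewrite expR_le1 oppr_le0 divr_ge0// mulr_ge0 ?sqr_ge0// ltW//.
have := ler_wpM2r (normr_ge0 (expR tau - 1)) E1; lra.
Qed.

Lemma sqrt_normal_approx (R : realType) (l x : R) : 0 < l ->
  Num.sqrt l * normal_approx l x =
  expR (- ((x - l) ^+ 2 / (2 * l))) / Num.sqrt (2 * pi).
Proof.
move=> l0; have p0 : 0 < 2 * pi :> R by rewrite mulr_gt0// pi_gt0.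
rewrite /normal_approx sqrtrM ?(ltW p0)//; field.
by rewrite !gt_eqF// sqrtr_gt0.
Qed.

Lemma sqrt_2pi_ge1 (R : realType) : 1 <= Num.sqrt (2 * pi) :> R.
Proof.
rewrite -[leLHS]sqrtr1 ler_wsqrtr//; have := pi_ge2 R; lra.
Qed.

Lemma normal_approx_tail (R : realType) (K l x : R) : 0 < K -> 0 < l ->
  K * Num.sqrt l <= `|x - l| -> 0 <= Num.sqrt l * normal_approx l x <= K^-1.
Proof.
move=> K0 l0 xl; rewrite sqrt_normal_approx//.
have s1 := sqrt_2pi_ge1 R; have s0 : 0 < Num.sqrt (2 * pi) :> R by lra.
rewrite divr_ge0 ?expR_ge0 ?(ltW s0)//= ler_pdivrMr//.
set t := (x - l) ^+ 2 / (2 * l).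
have t2 : K ^+ 2 / 2 <= t.
  rewrite /t ler_pdivlMr ?mulr_gt0// (_ : _ * (2 * l) = K ^+ 2 * l); last by field.
  rewrite -{1}(sqr_sqrtr (ltW l0)) -exprMn -[leRHS]ger0_norm ?sqr_ge0// normrX.
  by rewrite lerXn2r ?nnegrE ?mulr_ge0 ?sqrtr_ge0// ltW.
(* Uses [expR t >= 1 + t >= 1 + K ^+ 2 / 2 >= K]. *)
have : expR (- t) <= K^-1.
  rewrite expRN lef_pV2 ?posrE ?expR_gt0// (le_trans _ (expR_ge1Dx t))//.
  by have := sqr_ge0 (K - 1); rewrite sqrrB1; lra.
move=> H; apply: (le_trans H); rewrite ler_peMr// invr_ge0 ltW//.
Qed.

Lemma pois_local_limit (R : realType) (e : R) : 0 < e ->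
  exists L : R, forall l, L <= l ->
    [/\ 0 < l,
      forall j : nat, Num.sqrt l * `|pois l j - normal_approx l j%:R| <= e &
      forall x, x <= 0 -> Num.sqrt l * `|normal_approx l x| <= e].
Proof.
move=> e0; pose K := 2 / e + 1.
have K1 : 1 <= K by rewrite /K lerDr divr_ge0// ltW.
have K0 : 0 < K by lra.
have Ke : K^-1 <= e / 2.
  rewrite -[leRHS]invrK lef_pV2 ?posrE// ?invr_gt0 ?divr_gt0// invf_div.
  by rewrite /K lerDl.
have [L HL] := pois_bulk K1 e0.
(* The bound [K ^+ 2 <= l] gives [K * sqrt l <= l], so nonpositive points lie outside the central
   window. *)
exists (Num.max L (K ^+ 2)) => l; rewrite ge_max => /andP[/HL {}HL lK].
have l0 : 0 < l by rewrite (lt_le_trans _ lK)// exprn_gt0.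
have sl : 0 < Num.sqrt l by rewrite sqrtr_gt0.
have s1 := sqrt_2pi_ge1 R; have s0 : 0 < Num.sqrt (2 * pi) :> R by lra.
split=> // [j|x x0].
  have [jl|jl] := leP `|j%:R - l| (K * Num.sqrt l).
    rewrite -[Num.sqrt l in leLHS](gtr0_norm sl) -normrM mulrBr sqrt_normal_approx//.
    have -> : Num.sqrt l * pois l j - expR (- ((j%:R - l) ^+ 2 / (2 * l))) / Num.sqrt (2 * pi)
      = (Num.sqrt (2 * pi) * Num.sqrt l * pois l j
        - expR (- ((j%:R - l) ^+ 2 / (2 * l)))) / Num.sqrt (2 * pi).
      by rewrite mulrBl; congr (_ - _); field; rewrite gt_eqF.
    rewrite normrM normfV (gtr0_norm s0) ler_pdivrMr// (le_trans (HL _ jl))//.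
    by rewrite ler_peMr// ltW.
  have /andP[N1 N2] := normal_approx_tail K0 l0 (ltW jl).
  have P : Num.sqrt l * pois l j <= K^-1.
    rewrite -[leRHS]mul1r ler_pdivlMr// mulrC mulrA (le_trans _ (pois_dist_le1 j l0))//.
    by rewrite ler_wpM2r// ltW// pois_gt0.
  have P0 : 0 <= Num.sqrt l * pois l j by rewrite mulr_ge0 ?ltW// pois_gt0.
  rewrite -[Num.sqrt l in leLHS](gtr0_norm sl) -normrM mulrBr ler_norml.
  by apply/andP; split; lra.
have xl : K * Num.sqrt l <= `|x - l|.
  rewrite distrC ger0_norm; last by lra.
  apply: (@le_trans _ _ l); last by lra.
  rewrite -{2}(sqr_sqrtr (ltW l0)) expr2 ler_wpM2r ?sqrtr_ge0//.
  by rewrite -(@ler_sqr _ K) ?nnegrE ?sqrtr_ge0 ?(ltW K0)// sqr_sqrtr// ltW.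
have /andP[N1 N2] := normal_approx_tail K0 l0 xl.
rewrite -[Num.sqrt l in leLHS](gtr0_norm sl) -normrM ger0_norm//; lra.
Qed.

(** * Local limit theorem for the r-Lah law *)

Lemma ln_nat_ge (R : realType) (M : R) :
  exists N : nat, forall n, (N <= n)%N -> M <= ln n%:R.
Proof.
exists (Num.bound (expR M)) => n Nn.
have H : expR M <= n%:R.
  apply: (@le_trans _ _ (Num.bound (expR M))%:R); last by rewrite ler_nat.
  exact/ltW/archi_boundP/expR_ge0.
have n0 : 0 < n%:R :> R by rewrite (lt_le_trans (expR_gt0 M)).
by rewrite -[leLHS]expRK ler_ln ?posrE ?expR_gt0.
Qed.

Lemma rlah_pmf_pois (R : realType) (k : nat) (r : R) :
  0 <= r -> 0 < k%:R + r ->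
  exists C N, [/\ 0 <= C, (1 < N)%N & forall n, (N <= n)%N -> forall j : nat,
    `|rlah_pmf r n k j - pois ((k%:R + r) * ln n%:R) j| <= C / ln n%:R].
Proof.
move=> r0 th0; set th := k%:R + r.
have [K [K0 HK]] := rlah_pmf_bern r0 th0.
pose c := th + r; have thc : th <= c by rewrite lerDl.
have c0 : 0 < c by rewrite (lt_le_trans th0).
(* The bound of [sum_bern_ln] plus twice that of [sum_bern_sqr_le], as they enter
   [bernE_pois_le]. *)
pose D := (1 + 2 * (th * (c + 1))) + 2 * (1 + 2 * th ^+ 2).
have D0 : 0 <= D by rewrite /D; have : 0 < th := th0; nra.
exists (2 * K + D / th), (Num.bound K).+2; split => //.
  by apply: addr_ge0; [exact: mulr_ge0|apply: divr_ge0 => //; exact: ltW].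
move=> n Nn j.
have n1 : 1 < n%:R :> R by rewrite ltr1n (leq_trans _ Nn).
have n0 : 0 < n%:R :> R by lra.
have n0' : (0 < n)%N by rewrite -(ltr0n R).
have l0 : 0 < ln n%:R :> R by rewrite ln_gt0.
have Kn : K <= n%:R.
  apply: (@le_trans _ _ (Num.bound K)%:R); first exact/ltW/archi_boundP.
  by rewrite ler_nat (leq_trans _ Nn)// -addn2 leq_addr.
have p01 i : 0 <= th / (c + i%:R) <= 1.
  have ci : 0 < c + i%:R by rewrite ltr_wpDr.
  by rewrite divr_ge0 ?(ltW th0) ?(ltW ci)//= ler_pdivrMr// mul1r (le_trans thc)// lerDl.
have tl0 : 0 < th * ln n%:R by rewrite mulr_gt0.
have H1 := HK n n0' Kn j.
have H2 := bernE_pois_le n j p01 tl0.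
apply: (le_trans (ler_distD (bernE (fun m => th / (c + m%:R)) n (fun m => (m == j)%:R)) _ _)).
rewrite [leRHS]mulrDl lerD//.
  apply: (le_trans H1); rewrite ler_wpM2l ?mulr_ge0// lef_pV2 ?posrE//.
  exact/ltW/ln_sublinear.
apply: (le_trans H2); rewrite -[leRHS]mulrA -invfM ler_wpM2r ?invr_ge0 ?(ltW tl0)//.
rewrite /D lerD// ?sum_bern_ln// ler_wpM2l//.
exact: (sum_bern_sqr_le n th0 thc).
Qed.

Lemma rlah_pmf_local_limit (R : realType) (k : nat) (r e : R) :
  0 <= r -> 0 < k%:R + r -> 0 < e ->
  exists N, forall n, (N <= n)%N -> 0 < ln n%:R :> R /\ forall j : int,
    Num.sqrt (ln n%:R) *
      `|rlah_pmf r n k j - normal_approx ((k%:R + r) * ln n%:R) j%:~R| <= e.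
Proof.
move=> r0 th0 e0; set th := k%:R + r.
have [C [N1 [C0 N11 HC]]] := rlah_pmf_pois r0 th0.
have st0 : 0 < Num.sqrt th by rewrite sqrtr_gt0.
have e20 : 0 < e / 2 * Num.sqrt th by rewrite mulr_gt0// divr_gt0.
have [L HL] := pois_local_limit e20.
(* The first entry makes the Poisson parameter at least [L]; the second makes [C / sqrt (ln n)] at
   most [e / 2]. *)
pose M := Num.max (L / th) ((2 * C / e) ^+ 2).
have [N2 HN2] := ln_nat_ge M.
exists (maxn N1 N2) => n; rewrite geq_max => /andP[n1 n2].
have n1' : 1 < n%:R :> R by rewrite ltr1n (leq_trans N11).
have l0 : 0 < ln n%:R :> R by rewrite ln_gt0.
have := HN2 n n2; rewrite /M ge_max => /andP[LM CM].
have Ll : L <= th * ln n%:R by rewrite mulrC -ler_pdivrMr.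
have [tl0 P1 P2] := HL _ Ll.
set w := Num.sqrt (ln n%:R).
have w0 : 0 < w by rewrite sqrtr_gt0.
have w2 : w ^+ 2 = ln n%:R by rewrite sqr_sqrtr// ltW.
have wC : C / w <= e / 2.
  have : 2 * C / e <= w.
    rewrite -(@ler_sqr _ _ w) ?nnegrE ?(ltW w0) ?w2//.
    by rewrite divr_ge0 ?mulr_ge0// ltW.
  by rewrite !ler_pdivrMr// => ?; rewrite mulrAC ler_pdivlMr//; lra.
(* Passes from the scale [sqrt (th * ln n)] of the Poisson limit to [sqrt (ln n)], which explains
   the tolerance [e / 2 * Num.sqrt th]. *)
have sE x : Num.sqrt (th * ln n%:R) * x <= e / 2 * Num.sqrt th -> w * x <= e / 2.
  by rewrite sqrtrM ?(ltW th0)// -/w -mulrA [X in X <= _ -> _]mulrC ler_pM2r.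
split=> // j; case: j => j.
  rewrite (le_trans (ler_wpM2l (ltW w0) (ler_distD (pois (th * ln n%:R) j) _ _)))//.
  rewrite mulrDr [leRHS]splitr lerD//; last exact: sE.
  apply: le_trans wC; apply: (le_trans (ler_wpM2l (ltW w0) (HC n n1 j))).
  by rewrite -w2 le_eqVlt; apply/orP; left; apply/eqP; field; rewrite gt_eqF.
(* At negative integers the mass is 0 and only the Gaussian tail remains. *)
rewrite sub0r normrN.
have x0 : (Negz j)%:~R <= 0 :> R by rewrite NegzE mulrNz oppr_le0 ler0z.
have := sE _ (P2 _ x0); lra.
Qed.

Lemma cvge0_le (R : realType) (u : nat -> \bar R) :
  (forall e : R, 0 < e -> exists N, forall n, (N <= n)%N -> (0 <= u n <= e%:E)%E) ->
  (u n @[n --> \oo] --> 0%E)%classic.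
Proof.
move=> H; apply/fine_cvgP; split.
  have [N HN] := H 1 ltr01; exists N => // n /= /HN /andP[u0 u1].
  by rewrite ge0_fin_numE// (le_lt_trans u1)// ltry.
apply/cvgrPdist_le => e e0; have [N HN] := H e e0.
exists N => // n /= /HN; case: (u n) => [x| |] //=.
  by rewrite !lee_fin => /andP[x0 xe]; rewrite sub0r normrN ger0_norm.
by rewrite leye_eq andbF.
Qed.

Local Open Scope classical_set_scope.
Local Open Scope ereal_scope.

Theorem theorem3p20 (R : realType) (k : nat) (r : R)
  (hr : (0 <= r)%R) (hkr : (0 < Num.max k%:R r)%R)
  (d : nat -> measure_display) (T : forall n : nat, measurableType (d n))
  (P : forall n : nat, probability (T n) R)
  (X : forall n : nat, {RV (P n) >-> R})
  (hX : forall n : nat, (0 < n)%N -> (k <= n)%N ->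
    has_rlah_distribution (X n) r n k) :
  (Num.sqrt (ln n%:R))%:E *
    ereal_sup [set `| P n (X n @^-1` [set j%:~R%R])
                      - (normal_approx ((k%:R + r) * ln n%:R) j%:~R)%:E |
              | j in [set: int]]
    @[n --> \oo] --> 0.
Proof.
have th0 : (0 < k%:R + r)%R.
  by move: hkr; rewrite lt_max => /orP[k0|r0]; [rewrite ltr_wpDr|rewrite ltr_wpDl].
apply: cvge0_le => e e0.
have [N HN] := rlah_pmf_local_limit hr th0 e0.
(* The law of [X n] is prescribed only for [0 < n] and [k <= n]. *)
exists (maxn N (maxn 1 k)) => n; rewrite !geq_max => /and3P[/HN[l0 {}HN] n0 kn].
have w0 : (0 < Num.sqrt (ln (n%:R : R)))%R by rewrite sqrtr_gt0.
set w := Num.sqrt _ in w0 HN *.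
apply/andP; split.
  rewrite mule_ge0 ?lee_fin ?(ltW w0)//.
  (* The supremum dominates its member at [j = 0], which is nonnegative. *)
  by apply: le_trans (ereal_sup_ubound (imageT _ 0%R)); exact: abse_ge0.
apply: (@le_trans _ _ (w%:E * (e / w)%:E)); last first.
  by rewrite -EFinM lee_fin mulrC divfK// gt_eqF.
rewrite lee_wpmul2l ?lee_fin ?(ltW w0)//.
apply: ge_ereal_sup => _ [j _ <-]; rewrite (hX n n0 kn) -EFinB /= lee_fin.
by rewrite ler_pdivlMr// mulrC.
Qed.
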